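(* Let $K$ be a field and consider a pullback square of Lie algebras over $K$ consisting of homomorphisms $f:\mathfrak g\to\mathfrak h$, $f':\mathfrak g'\to\mathfrak h'$ and monomorphisms $i:\mathfrak g'\hookrightarrow\mathfrak g$, $j:\mathfrak h'\hookrightarrow\mathfrak h$ with $f\circ i=j\circ f'$; that is, identifying $\mathfrak h'$ and $\mathfrak g'$ with their images under $j$ and $i$, $\mathfrak g'=f^{-1}(\mathfrak h')$. Then $\operatorname{cd}(f')\le\operatorname{cd}(f)$.
   Context: Lie algebras are over a field $K$ and may be infinite-dimensional. Modules over a Lie algebra $\mathfrak g$ are left $\mathfrak g$-modules, equivalently left modules over the universal enveloping algebra $U(\mathfrak g)$ (no finiteness assumption). $H^n(\mathfrak g,M)$ denotes Chevalley--Eilenberg cohomology (equivalently $\operatorname{Ext}^n_{U(\mathfrak g)}(K,M)$). For a Lie algebra homomorphism $\phi:\mathfrak g\to\mathfrak h$ and an $\mathfrak h$-module $M$, regarded as a $\mathfrak g$-module by restriction along $\phi$, there is an induced map $\phi^*:H^n(\mathfrak h,M)\to H^n(\mathfrak g,M)$ for each $n\ge 0$. The cohomological dimension of $\phi$ is $$\operatorname{cd}(\phi)=\sup\{n\ge 0:\ \text{there is an }\mathfrak h\text{-module }M\text{ with }\phi^*:H^n(\mathfrak h,M)\to H^n(\mathfrak g,M)\text{ nonzero}\},$$ a value in $\{0,1,2,\dots\}\cup\{\infty\}$. *)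

(* Defs.v *)
From HB Require Import structures.
From mathcomp Require Import all_boot all_order all_algebra.
From mathcomp Require Import all_classical constructive_ereal.

Set Implicit Arguments.
Unset Strict Implicit.
Unset Printing Implicit Defensive.

Import Order.TTheory GRing.Theory Num.Theory.

Local Open Scope classical_set_scope.
Local Open Scope ring_scope.

(* The bracket is alternating, not merely antisymmetric, so that the
   definition is the right one in characteristic 2 as well. *)
HB.mixin Record Lmodule_isLieAlgebra (K : fieldType) L of GRing.Lmodule K L := {
  lie : L -> L -> L;
  lie_linearl : forall y, linear (lie^~ y);
  lie_linearr : forall x, linear (lie x);
  lie_alt : forall x, lie x x = 0;
  lie_jacobi : forall x y z,
    lie x (lie y z) + lie y (lie z x) + lie z (lie x y) = 0
}.

#[short(type="lieAlgType")]
HB.structure Definition LieAlgebra (K : fieldType) :=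
  {L of Lmodule_isLieAlgebra K L & GRing.Lmodule K L}.

HB.mixin Record isLieMorphism (K : fieldType) (g h : lieAlgType K)
    (phi : g -> h) := {
  lie_morphM : forall x y, phi (lie x y) = lie (phi x) (phi y)
}.

#[short(type="lieHom")]
HB.structure Definition LieMorphism (K : fieldType) (g h : lieAlgType K) :=
  {phi of isLieMorphism K g h phi & @GRing.Linear K g h *:%R phi}.

HB.mixin Record Lmodule_isLieModule (K : fieldType) (g : lieAlgType K) M
    of GRing.Lmodule K M := {
  lact : g -> M -> M;
  lact_linearl : forall m, linear (lact^~ m);
  lact_linearr : forall x, linear (lact x);
  lact_lie : forall x y m,
    lact (lie x y) m = lact x (lact y m) - lact y (lact x m)
}.

#[short(type="lieModType")]
HB.structure Definition LieModule (K : fieldType) (g : lieAlgType K) :=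
  {M of Lmodule_isLieModule K g M & GRing.Lmodule K M}.

(* [restrict_mod phi M] is a copy of the vector space [M] carrying the g-module
   structure x . m := phi x . m. *)
Definition restrict_mod (K : fieldType) (g h : lieAlgType K) (phi : lieHom g h)
  (M : lieModType h) : Type := M.

Section Restriction.
Variables (K : fieldType) (g h : lieAlgType K) (phi : lieHom g h).
Variable M : lieModType h.

HB.instance Definition _ := GRing.Lmodule.on (restrict_mod phi M).

Definition restrict_act (x : g) (m : restrict_mod phi M) : restrict_mod phi M :=
  lact (phi x) (m : M).

Fact restrict_act_linearl m : linear (restrict_act^~ m).
Proof. by move=> a x y; rewrite /restrict_act linearP lact_linearl. Qed.

Fact restrict_act_linearr x : linear (restrict_act x).
Proof. by move=> a m p; rewrite /restrict_act lact_linearr. Qed.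

Fact restrict_act_lie x y m : restrict_act (lie x y) m =
  restrict_act x (restrict_act y m) - restrict_act y (restrict_act x m).
Proof. by rewrite /restrict_act lie_morphM lact_lie. Qed.

HB.instance Definition _ := Lmodule_isLieModule.Build K g (restrict_mod phi M)
  restrict_act_linearl restrict_act_linearr restrict_act_lie.
End Restriction.

Section ChevalleyEilenberg.
Variables (K : fieldType) (g : lieAlgType K) (M : lieModType g).

(* An n-cochain is an alternating n-linear map g^n -> M, i.e. a linear map
   from the n-th exterior power of g to M. *)
Definition multilinear n (w : ('I_n -> g) -> M) :=
  forall (i : 'I_n) (x : 'I_n -> g) (a : K) (u v : g),
    w (dfwith x i (a *: u + v)) = a *: w (dfwith x i u) + w (dfwith x i v).

Definition alternating n (w : ('I_n -> g) -> M) :=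
  forall (x : 'I_n -> g) (i j : 'I_n), i != j -> x i = x j -> w x = 0.

Definition is_cochain n (w : ('I_n -> g) -> M) :=
  multilinear w /\ alternating w.

(* For i < j, the n-tuple ([x_i, x_j], x_0, .., ^x_i, .., ^x_j, .., x_n):
   the m-th entry of x_0, .., x_n with the i-th and j-th ones removed has
   index bump j (bump i m). *)
Definition lie_contract n (x : 'I_n.+1 -> g) (i j : 'I_n.+1) (k : 'I_n) : g :=
  if k == 0 :> nat then lie (x i) (x j) else x (inord (bump j (bump i k.-1))).

Definition ce_diff n (w : ('I_n -> g) -> M) (x : 'I_n.+1 -> g) : M :=
  \sum_(i < n.+1) (-1) ^+ i *: lact (x i) (w (fun k => x (lift i k))) +
  \sum_(i < n.+1) \sum_(j < n.+1 | (i < j)%N)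
     (-1) ^+ (i + j) *: w (lie_contract x i j).

Definition is_cocycle n (w : ('I_n -> g) -> M) :=
  is_cochain w /\ forall x, ce_diff w x = 0.

Definition is_coboundary n : (('I_n -> g) -> M) -> Prop :=
  match n with
  | 0 => fun w => forall x, w x = 0
  | p.+1 => fun w =>
      exists2 e : ('I_p -> g) -> M, is_cochain e & forall x, w x = ce_diff e x
  end.

Fact is_cochain0 n : is_cochain (fun _ : 'I_n -> g => 0 : M).
Proof. by split=> [i x a u v|//]; rewrite scaler0 addr0. Qed.

Fact is_cochainB n (w1 w2 : ('I_n -> g) -> M) :
  is_cochain w1 -> is_cochain w2 -> is_cochain (fun x => w1 x - w2 x).
Proof.
move=> [l1 a1] [l2 a2]; split=> [i x a u v|x i j ij xij].
  by rewrite l1 l2 scalerBr opprD addrACA.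
by rewrite (a1 x i j) // (a2 x i j) // subr0.
Qed.

Fact lact0 (x : g) : lact x (0 : M) = 0.
Proof.
by have := lact_linearr x (-1) 0 (0 : M); rewrite scaler0 addr0 scaleN1r addNr. Qed.

Fact lactB (x : g) (u v : M) : lact x (u - v) = lact x u - lact x v.
Proof. by rewrite -!scaleN1r ![_ + _ *: _]addrC lact_linearr. Qed.

Fact ce_diff0 n x : ce_diff (fun _ : 'I_n -> g => 0 : M) x = 0.
Proof.
rewrite /ce_diff [X in X + _]big1 => [|i _]; last by rewrite lact0 scaler0.
by rewrite add0r big1 // => i _; rewrite big1 // => j _; rewrite scaler0.
Qed.

Fact ce_diffB n (w1 w2 : ('I_n -> g) -> M) x :
  ce_diff (fun y => w1 y - w2 y) x = ce_diff w1 x - ce_diff w2 x.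
Proof.
rewrite /ce_diff opprD addrACA; congr (_ + _).
  by rewrite -sumrB; apply: eq_bigr => i _; rewrite lactB scalerBr.
rewrite -sumrB; apply: eq_bigr => i _.
by rewrite -sumrB; apply: eq_bigr => j _; rewrite scalerBr.
Qed.

Definition cocycle_pred n : {pred ('I_n -> g) -> M} :=
  fun w => `[< is_cocycle w >].

Fact cocycle_zmod_closed n : zmod_closed (@cocycle_pred n).
Proof.
split=> [|w1 w2 /asboolP[c1 d1] /asboolP[c2 d2]]; apply/asboolP; split.
- exact: is_cochain0.
- exact: ce_diff0.
- exact: is_cochainB.
- by move=> x; rewrite ce_diffB d1 d2 subr0.
Qed.

HB.instance Definition _ n :=
  GRing.isZmodClosed.Build _ (@cocycle_pred n) (@cocycle_zmod_closed n).

Record cocycle n := Cocycle {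
  cocycle_val :> ('I_n -> g) -> M;
  cocycleP : cocycle_val \in @cocycle_pred n
}.

HB.instance Definition _ n := [isSub for @cocycle_val n].
HB.instance Definition _ n := [Choice of cocycle n by <:].
HB.instance Definition _ n := [SubChoice_isSubZmodule of cocycle n by <:].

Definition coboundary_pred n : {pred cocycle n} :=
  fun z => `[< is_coboundary z >].

Fact coboundary_zmod_closed n : zmod_closed (@coboundary_pred n).
Proof.
split=> [|z1 z2 /asboolP b1 /asboolP b2]; apply/asboolP.
  case: n => [//|p]; exists (fun=> 0); first exact: is_cochain0.
  by move=> x; rewrite ce_diff0.
case: n z1 z2 b1 b2 => [z1 z2 b1 b2 x|p z1 z2 [e1 c1 d1] [e2 c2 d2]].
  by rewrite /= /GRing.add /= /GRing.opp /= b1 b2 subr0.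
exists (fun x => e1 x - e2 x); first exact: is_cochainB.
by move=> x; rewrite ce_diffB -d1 -d2.
Qed.

HB.instance Definition _ n :=
  GRing.isZmodClosed.Build _ (@coboundary_pred n) (@coboundary_zmod_closed n).

(* H^n(g, M) = Z^n / B^n, with B^n formed inside the type of cocycles *)
Definition cohomology n : zmodType := Quotient.quot (@coboundary_pred n).

Definition cohom_class n (z : cocycle n) : cohomology n :=
  (\pi_(Quotient.quot (@coboundary_pred n)) z)%qT.

End ChevalleyEilenberg.

Section InducedMap.
Variables (K : fieldType) (g h : lieAlgType K) (phi : lieHom g h).
Variable M : lieModType h.

Definition pull n (w : ('I_n -> h) -> M) : ('I_n -> g) -> restrict_mod phi M :=
  fun x => w (phi \o x).

Fact comp_dfwith n (x : 'I_n -> g) i u :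
  phi \o dfwith x i u = dfwith (phi \o x) i (phi u).
Proof.
apply/funext => k /=; case: (eqVneq i k) => [<-|ik].
  by rewrite !dfwithin.
by rewrite !dfwithout.
Qed.

Fact pull_cochain n (w : ('I_n -> h) -> M) :
  is_cochain w -> is_cochain (pull w).
Proof.
move=> [lw aw]; split=> [i x a u v|x i j ij xij].
  by rewrite /pull !comp_dfwith linearP lw.
by apply: (aw _ i j) => //=; rewrite xij.
Qed.

Fact pull_diff n (w : ('I_n -> h) -> M) x :
  ce_diff (pull w) x = ce_diff w (phi \o x).
Proof.
rewrite /ce_diff; congr (_ + _); apply: eq_bigr => i _; apply: eq_bigr => j _.
rewrite /pull; congr (_ *: w _); apply/funext => k /=.
by rewrite /lie_contract; case: ifP => // _; rewrite lie_morphM.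
Qed.

Fact pull_cocycle n (z : cocycle M n) :
  pull z \in @cocycle_pred K g (restrict_mod phi M) n.
Proof.
have /asboolP[cz dz] := cocycleP z; apply/asboolP; split=> [|x].
  exact: pull_cochain.
by rewrite pull_diff dz.
Qed.

Definition pullc n (z : cocycle M n) : cocycle (restrict_mod phi M) n :=
  Cocycle (pull_cocycle z).

(* phi^* : H^n(h, M) -> H^n(g, M), [w] |-> [w o phi^n] *)
Definition cohom_map n (c : cohomology M n) :
  cohomology (restrict_mod phi M) n :=
  cohom_class (pullc (repr c)).

(* The value of [cohom_map] does not depend on the representative. *)
Lemma cohom_mapE n (z : cocycle M n) :
  cohom_map (cohom_class z) = cohom_class (pullc z).
Proof.
rewrite /cohom_map /cohom_class.
apply/eqP; rewrite -Quotient.idealrBE; apply/asboolP.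
have : repr (cohom_class z) - z \in @coboundary_pred K h M n.
  by rewrite Quotient.idealrBE reprK.
move=> /asboolP; rewrite /cohom_class; set y := repr _.
case: n z y => [z y b x|p z y [e ce de]]; first exact: (b (phi \o x)).
exists (pull e); first exact: pull_cochain.
by move=> x; rewrite pull_diff -de.
Qed.

End InducedMap.

Definition nonzero_degrees (K : fieldType) (g h : lieAlgType K)
    (phi : lieHom g h) : set nat :=
  [set n | exists (M : lieModType h) (c : cohomology M n), cohom_map phi c != 0].

(* Supremum of a set of natural numbers in {0, 1, 2, ..} U {oo}, realized
   inside \bar int; the default 0 makes 0 the supremum of the empty set. *)
Definition degree_sup (S : set nat) : \bar int :=
  supremum 0%:E [set n%:Z%:E | n in S].

Lemma degree_sup_isLub (S : set nat) : S !=set0 ->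
  isLub [set n%:Z%:E | n in S] (degree_sup S).
Proof.
move=> [n0 Sn0]; set A := [set n%:Z%:E | n in S].
have A0 : A != set0 by apply/set0P; exists n0%:Z%:E; exists n0.
suff [m mA] : exists m, supremums A m.
  rewrite /degree_sup -/A /supremum (negbTE A0).
  by case: xgetP => [_ -> //|/(_ m) []].
have [[N SN]|unb] := pselect (exists N, forall n, S n -> (n <= N)%N).
  have exS : exists n, `[< S n >] by exists n0; apply/asboolP.
  have ubS n : `[< S n >] -> (n <= N)%N by move/asboolP => /SN.
  case: (ex_maxnP exS ubS) => m /asboolP Sm mmax.
  exists m%:Z%:E; split=> [_ [n Sn <-]|b]; last by apply; exists m.
  by rewrite lee_fin lez_nat mmax //; apply/asboolP.
exists +oo%E; split=> [? _|b ubb]; first exact: leey.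
have /= := ubb _ (ex_intro2 _ _ n0 Sn0 erefl).
case: b ubb => // r ubr _; exfalso; apply: unb; exists `|r|%N => n Sn.
have := ubr _ (ex_intro2 _ _ n Sn erefl); rewrite lee_fin => nr.
by rewrite -lez_nat (le_trans nr) // abszE ler_norm.
Qed.

Definition cd (K : fieldType) (g h : lieAlgType K) (phi : lieHom g h) :
  \bar int := degree_sup (nonzero_degrees phi).

(* Main.v *)
(* Shapiro's lemma: an h'-module M is the image, under an h'-linear map eps, of
   the h-module N coinduced from M, and every n-cocycle z of h' in M has the form
   eps (zN (j _)) for an n-cocycle zN of h in N.  As f i = j f', applying eps to
   the restriction of f^* zN along i gives f'^* z, so f^* [zN] = 0 would force
   f'^* [z] = 0.

   The coinduced module is built by hand, proving the Poincare-Birkhoff-Witt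
   theorem relative to h' on the way: its elements are functions on ordered words
   in a basis of a complement of h'.  The cocycle zN is defined by recursion on
   the length of words: if m is the largest letter of a word m v, the equation
   (d zN)(m, x_1, ..., x_n)(v) = 0 for x_i below m determines
   zN(x_1, ..., x_n)(m v).  The remaining components of d zN vanish by induction
   on the length of words, because d (d zN) = 0. *)
Require Import Defs.
From HB Require Import structures.
From mathcomp Require Import all_boot all_order all_algebra.
From mathcomp Require Import all_classical constructive_ereal.

Set Implicit Arguments.
Unset Strict Implicit.
Unset Printing Implicit Defensive.

Import Order.TTheory GRing.Theory Num.Theory.

Local Open Scope classical_set_scope.
Local Open Scope ring_scope.

(** * Linear maps and Lie brackets *)

Section LinearFacts.
Variables (K : fieldType) (U V : lmodType K) (G : U -> V).
Hypothesis G_lin : linear G.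

Lemma linear_fun0 : G 0 = 0.
Proof. by have := G_lin (-1) 0 0; rewrite scaler0 addr0 scaleN1r addNr. Qed.

Lemma linear_funD x y : G (x + y) = G x + G y.
Proof. by have := G_lin 1 x y; rewrite !scale1r. Qed.

Lemma linear_funZ a x : G (a *: x) = a *: G x.
Proof. by have := G_lin a x 0; rewrite !addr0 linear_fun0 addr0. Qed.

Lemma linear_funN x : G (- x) = - G x.
Proof. by rewrite -scaleN1r linear_funZ scaleN1r. Qed.

Lemma linear_funB x y : G (x - y) = G x - G y.
Proof. by rewrite linear_funD linear_funN. Qed.

Lemma linear_fun_sum (I : Type) (r : seq I) (P : pred I) (F : I -> U) :
  G (\sum_(i <- r | P i) F i) = \sum_(i <- r | P i) G (F i).
Proof. exact: (big_morph G linear_funD linear_fun0). Qed.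

Lemma linear_comb_sub (G' : U -> V) : linear G' -> linear (fun x => G x - G' x).
Proof.
by move=> G'_lin a x y; rewrite G_lin G'_lin scalerBr opprD addrACA.
Qed.
End LinearFacts.

Section LieFacts.
Variables (K : fieldType) (g : lieAlgType K).
Implicit Types x y z : g.

Lemma lieC x y : lie x y = - lie y x.
Proof.
have := lie_alt (x + y).
rewrite (linear_funD (lie_linearl _)) !(linear_funD (lie_linearr _)).
by rewrite !lie_alt add0r addr0 => /eqP; rewrite addr_eq0 => /eqP.
Qed.

Lemma lie_lie x y z : lie (lie x y) z = lie x (lie y z) - lie y (lie x z).
Proof.
have := lie_jacobi x y z.
rewrite (lieC z (lie x y)) (lieC z x) (linear_funN (lie_linearr _)) => /eqP.
by rewrite subr_eq0 => /eqP <-.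
Qed.
End LieFacts.

(** * Multilinear maps on lists *)

Section Multilinear.
Variables (K : fieldType) (U V : lmodType K).
Implicit Types (x y : U) (s : seq U) (w : seq U -> V).

(** The interior product [iota_x w] of a cochain with a vector. *)
Definition ins w x : seq U -> V := fun s => w (x :: s).

Definition multilin w := forall s1 s2 a x y,
  w (s1 ++ (a *: x + y) :: s2) = a *: w (s1 ++ x :: s2) + w (s1 ++ y :: s2).

Definition altern w := forall s1 s2 x, w (s1 ++ [:: x, x & s2]) = 0.

Lemma multilin_ins w x : multilin w -> multilin (ins w x).
Proof. by move=> wl s1 s2 a y z; rewrite /ins -!cat_cons wl. Qed.

Lemma altern_ins w x : altern w -> altern (ins w x).
Proof. by move=> wa s1 s2 y; rewrite /ins -cat_cons wa. Qed.

Lemma multilin_linear w s1 s2 : multilin w -> linear (fun x => w (s1 ++ x :: s2)).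
Proof. by move=> wl a x y; rewrite wl. Qed.

Lemma multilin_head w s : multilin w -> linear (fun x => w (x :: s)).
Proof. exact: (multilin_linear [::]). Qed.

Lemma ins_linear w a x y : multilin w ->
  ins w (a *: x + y) = (fun s => a *: ins w x s + ins w y s).
Proof. by move=> wl; apply/funext => s; rewrite /ins (multilin_head s wl). Qed.

Lemma ins_comb a w1 w2 x :
  ins (fun t => a *: w1 t + w2 t) x = (fun t => a *: ins w1 x t + ins w2 x t).
Proof. by []. Qed.

Lemma multilinB w1 w2 :
  multilin w1 -> multilin w2 -> multilin (fun s => w1 s - w2 s).
Proof.
by move=> l1 l2 s1 s2 a x y; rewrite l1 l2 scalerBr opprD addrACA.
Qed.

Lemma altern_swap w s1 s2 x y : multilin w -> altern w ->
  w (s1 ++ [:: x, y & s2]) = - w (s1 ++ [:: y, x & s2]).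
Proof.
move=> wl wa; have := wa s1 s2 (x + y).
have lin t z u := linear_funD (multilin_linear (s1 ++ t) s2 wl) z u.
have := lin [:: x + y] x y; rewrite -!catA /= => ->.
rewrite !(linear_funD (multilin_linear s1 _ wl)) !wa add0r addr0 => /eqP.
by rewrite addr_eq0 => /eqP ->; rewrite opprK.
Qed.

Lemma altern_front w s1 s2 x : multilin w -> altern w ->
  w (s1 ++ x :: s2) = (-1) ^+ size s1 *: w (x :: s1 ++ s2).
Proof.
move=> + wa; elim: s1 w wa => [|y s1 IH] w wa wl /=; first by rewrite scale1r.
have -> : w (y :: s1 ++ x :: s2) = ins w y (s1 ++ x :: s2) by [].
rewrite IH; [|exact: altern_ins|exact: multilin_ins].
rewrite /ins [w _](@altern_swap w [::]) // exprS mulN1r scaleNr.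
by rewrite scalerN.
Qed.

Lemma altern_mem2 w x s : multilin w -> altern w -> x \in s -> w (x :: s) = 0.
Proof.
move=> wl wa /splitPr[s1 s2].
rewrite -cat_cons altern_front //= (wa [::]); exact: scaler0.
Qed.

Lemma ins_ins0 w x : altern w -> ins (ins w x) x = fun=> 0.
Proof. by move=> wa; apply/funext => s; exact: (wa [::]). Qed.

Lemma multilin0 : multilin (fun=> 0).
Proof. by move=> s1 s2 a x y /=; rewrite scaler0 addr0. Qed.

Lemma multilin_mem0 w s : multilin w -> 0 \in s -> w s = 0.
Proof.
move=> wl /splitPr[s1 s2]; exact: linear_fun0 (multilin_linear s1 s2 wl).
Qed.

End Multilinear.

Lemma multilin_comp (K : fieldType) (U V W : lmodType K) (p : U -> V)
  (w : seq V -> W) : linear p -> multilin w -> multilin (fun s => w (map p s)).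
Proof. by move=> pl wl s1 s2 a x y; rewrite !map_cat /= pl wl. Qed.

Lemma altern_comp (K : fieldType) (U V W : lmodType K) (p : U -> V)
  (w : seq V -> W) : altern w -> altern (fun s => w (map p s)).
Proof. by move=> wa s1 s2 x; rewrite map_cat /= wa. Qed.

(** * The Chevalley-Eilenberg complex on lists *)

(* Cochains of all degrees at once are functions on lists, so that the
   insertion operator [w o cons x] and the Lie derivative are total operations
   and the differential is given by Cartan's formula. *)
Section ListComplex.
Variables (K : fieldType) (g : lieAlgType K) (M : lieModType g).
Implicit Types (x y : g) (s : seq g) (w : seq g -> M).

Fixpoint ad_sum x w s : M :=
  if s is y :: t then w (lie x y :: t) + ad_sum x (ins w y) t else 0.

Definition lie_der x w s : M := lact x (w s) - ad_sum x w s.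

Fixpoint ldiff w s : M :=
  if s is x :: t then lie_der x w t - ldiff (ins w x) t else 0.

Lemma ad_sum_linear x a w1 w2 s :
  ad_sum x (fun t => a *: w1 t + w2 t) s = a *: ad_sum x w1 s + ad_sum x w2 s.
Proof.
elim: s w1 w2 => [|y s IH] w1 w2 /=; first by rewrite scaler0 addr0.
by rewrite ins_comb IH scalerDr addrACA.
Qed.

Lemma ad_sum_linearl w s : multilin w -> linear (fun x => ad_sum x w s).
Proof.
elim: s w => [|z s IH] w wl a x y /=; first by rewrite scaler0 addr0.
rewrite lie_linearl (multilin_head _ wl) (IH _ (multilin_ins z wl)) scalerDr.
by rewrite addrACA.
Qed.

Lemma multilin_ad_sum x w : multilin w -> multilin (ad_sum x w).
Proof.
move=> wl s1; elim: s1 w wl => [|z s1 IH] w wl s2 a u v /=.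
  rewrite lie_linearr (multilin_head _ wl) (ins_linear _ _ _ wl) ad_sum_linear.
  by rewrite scalerDr addrACA.
rewrite -cat_cons wl (IH _ (multilin_ins z wl)) /= scalerDr.
by rewrite addrACA.
Qed.

Lemma lie_der_linear x a w1 w2 s :
  lie_der x (fun t => a *: w1 t + w2 t) s = a *: lie_der x w1 s + lie_der x w2 s.
Proof.
by rewrite /lie_der ad_sum_linear lact_linearr scalerBr opprD addrACA.
Qed.

Lemma lie_derB x w1 w2 :
  lie_der x (fun t => w1 t - w2 t) = (fun s => lie_der x w1 s - lie_der x w2 s).
Proof.
apply/funext => s; have := lie_der_linear x (-1) w2 w1 s.
rewrite scaleN1r addrC => <-.
by congr (lie_der x _ s); apply/funext => t; rewrite scaleN1r addrC.
Qed.

Lemma ldiff_linear a w1 w2 s :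
  ldiff (fun t => a *: w1 t + w2 t) s = a *: ldiff w1 s + ldiff w2 s.
Proof.
elim: s w1 w2 => [|x s IH] w1 w2 /=; first by rewrite scaler0 addr0.
rewrite lie_der_linear ins_comb IH.
by rewrite /lie_der !scalerBr opprD addrACA.
Qed.

Lemma ldiffB w1 w2 :
  ldiff (fun t => w1 t - w2 t) = (fun s => ldiff w1 s - ldiff w2 s).
Proof.
apply/funext => s; have := ldiff_linear (-1) w2 w1 s.
rewrite scaleN1r addrC => <-.
by congr (ldiff _ s); apply/funext => t; rewrite scaleN1r addrC.
Qed.

Lemma multilin_lie_der x w : multilin w -> multilin (lie_der x w).
Proof.
move=> wl; apply: multilinB (multilin_ad_sum x wl) => s1 s2 a y z.
by rewrite wl lact_linearr.
Qed.

Lemma lie_der_linearl w s : multilin w -> linear (fun x => lie_der x w s).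
Proof.
move=> wl a x y; rewrite /lie_der lact_linearl (ad_sum_linearl _ wl).
by rewrite scalerBr opprD addrACA.
Qed.

Lemma multilin_ldiff w : multilin w -> multilin (ldiff w).
Proof.
move=> wl s1; elim: s1 w wl => [|z s1 IH] w wl s2 a x y /=.
  rewrite (lie_der_linearl _ wl) (ins_linear _ _ _ wl) ldiff_linear.
  by rewrite [in RHS]scalerBr opprD addrACA.
rewrite (multilin_lie_der z wl) (IH _ (multilin_ins z wl)).
by rewrite [in RHS]scalerBr opprD addrACA.
Qed.

Lemma ad_sum0 x s : ad_sum x (fun=> 0) s = 0.
Proof. by elim: s => //= y s IH; rewrite add0r -[RHS]IH. Qed.

Lemma ldiff0 s : ldiff (fun=> 0) s = 0.
Proof.
elim: s => //= x s IH; rewrite /lie_der ad_sum0 lact0 subrr sub0r.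
by have -> : ins (fun=> 0) x = (fun=> 0) :> (_ -> M) by []; rewrite IH oppr0.
Qed.

(** Bracketing the first or the second of two equal neighbours gives opposite terms; every other
    term keeps the repetition. *)
Lemma altern_ad_sum x w : multilin w -> altern w -> altern (ad_sum x w).
Proof.
move=> + + s1; elim: s1 w => [|y s1 IH] w wl wa s2 z /=.
  rewrite ins_ins0 // ad_sum0 addr0 /ins.
  by rewrite [w _](@altern_swap _ _ _ w [::]) // addNr.
rewrite -cat_cons wa add0r; apply: IH; first exact: multilin_ins.
exact: altern_ins.
Qed.

Lemma altern_lie_der x w : multilin w -> altern w -> altern (lie_der x w).
Proof.
by move=> wl wa s1 s2 y; rewrite /lie_der wa lact0 altern_ad_sum // subrr.
Qed.

(** Cartan's relation [[L_x, iota_y] = iota_[x,y]], the tool of the inductions on lists that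
    follow. *)
Lemma ins_lie_der x y w :
  ins (lie_der x w) y = fun s => lie_der x (ins w y) s - ins w (lie x y) s.
Proof.
by apply/funext => s; rewrite /ins /lie_der /= opprD addrCA addrC.
Qed.

(** With the repetition at the head, Cartan's formula leaves [iota_x L_x w - L_x iota_x w = -
    iota_[x,x] w], which is 0. *)
Lemma altern_ldiff w : multilin w -> altern w -> altern (ldiff w).
Proof.
move=> + + s1; elim: s1 w => [|y s1 IH] w wl wa s2 x /=.
  rewrite ins_ins0 // ldiff0 subr0.
  have /(congr1 (@^~ s2)) := ins_lie_der x x w; rewrite {1}/ins => ->.
  rewrite lie_alt /ins (linear_fun0 (multilin_head _ wl)) subr0.
  exact: subrr.
rewrite altern_lie_der // sub0r IH ?oppr0 //; first exact: multilin_ins.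
exact: altern_ins.
Qed.

(** The module axiom is the case of the empty list. For a head [z], moving both derivatives past
    [iota_z] leaves brackets with [z] that cancel by Jacobi. *)
Lemma lie_der_comm x y w s : multilin w ->
  lie_der x (lie_der y w) s - lie_der y (lie_der x w) s = lie_der (lie x y) w s.
Proof.
elim: s w => [|z s IH] w wl.
  by rewrite /lie_der /= !subr0 lact_lie.
have E u v : lie_der u (lie_der v w) (z :: s) =
    lie_der u (lie_der v (ins w z)) s - lie_der u (ins w (lie v z)) s
    - (lie_der v (ins w (lie u z)) s - ins w (lie v (lie u z)) s).
  have /(congr1 (@^~ s)) := ins_lie_der u z (lie_der v w).
  by rewrite {1}/ins => ->; rewrite !ins_lie_der lie_derB.
rewrite !E; have /(congr1 (@^~ s)) := ins_lie_der (lie x y) z w.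
rewrite {1}/ins => ->; rewrite -IH; last exact: multilin_ins.
rewrite lie_lie /ins (linear_funB (multilin_head _ wl)).
move: (lie_der x (lie_der y _) s) (lie_der y (lie_der x _) s).
move: (lie_der x _ s) (lie_der y _ s) (w _) (w _) => a b c d e f.
rewrite !opprD !opprK [- f + b + _]addrC addrACA subrKA.
by rewrite [- b + d]addrC [- f + b]addrC subrKA [d - f]addrC addrACA.
Qed.

(** After contraction with the head [y], the two sides differ by [[L_x, L_y] - L_[x,y]] and by an
    instance of the induction hypothesis for [iota_y w]. *)
Lemma lie_der_ldiff x w s : multilin w ->
  lie_der x (ldiff w) s = ldiff (lie_der x w) s.
Proof.
elim: s w => [|y s IH] w wl; first by rewrite /lie_der /= lact0 subr0.
have /(congr1 (@^~ s)) := ins_lie_der x y (ldiff w); rewrite {1}/ins => -> /=.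
rewrite -[ins (ldiff w) _]/(fun s => _) ins_lie_der.
have E u : ins (ldiff w) u = fun s => lie_der u w s - ldiff (ins w u) s by [].
rewrite !E lie_derB ldiffB IH; last exact: multilin_ins.
rewrite -lie_der_comm //.
move: (lie_der x _ s) (lie_der y _ s) (ldiff _ s) (ldiff _ s) => a b c d.
by rewrite !opprB addrC -addrA subrKA addrCA.
Qed.

(** Cartan's formula used twice gives [iota_x d d = L_x d - d L_x + d d iota_x]. *)
Lemma ldiffK w s : multilin w -> ldiff (ldiff w) s = 0.
Proof.
elim: s w => //= x s IH w wl.
have -> : ins (ldiff w) x = fun s => lie_der x w s - ldiff (ins w x) s by [].
rewrite ldiffB IH ?lie_der_ldiff //; last exact: multilin_ins.
by rewrite subr0 subrr.
Qed.

End ListComplex.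

(** * Comparison with cochains on tuples *)

Fixpoint delete (T : Type) i (s : seq T) : seq T :=
  match s, i with
  | [::], _ => [::]
  | _ :: t, 0 => t
  | x :: t, k.+1 => x :: delete k t
  end.

Lemma size_delete (T : Type) i (s : seq T) :
  (i < size s)%N -> size (delete i s) = (size s).-1.
Proof. by elim: s i => // x [|y s] IH [|i] //= /IH ->. Qed.

Lemma nth_delete (T : Type) (x0 : T) i s k :
  nth x0 (delete i s) k = nth x0 s (bump i k).
Proof.
elim: s i k => [|x s IH] [|i] [|k] //=; rewrite ?nth_nil // IH.
by rewrite bumpS.
Qed.

Lemma nth_codom_ord (T : Type) n (x : 'I_n -> T) (i : 'I_n) x0 :
  nth x0 (codom x) i = x i.
Proof. by rewrite (nth_map i) ?size_enum_ord // nth_ord_enum. Qed.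

Lemma size_codom_ord (T : Type) n (x : 'I_n -> T) : size (codom x) = n.
Proof. by rewrite size_codom card_ord. Qed.

Lemma codom_nth (T : Type) (x0 : T) n s :
  size s = n -> codom (fun i : 'I_n => nth x0 s i) = s.
Proof.
move=> sn; apply: (@eq_from_nth _ x0); rewrite size_codom_ord // => k kn.
exact: (nth_codom_ord _ (Ordinal kn)).
Qed.

Lemma codom_lift (T : Type) n (x : 'I_n.+1 -> T) (i : 'I_n.+1) :
  codom (fun k => x (lift i k)) = delete i (codom x).
Proof.
have x0 := x ord0; apply: (@eq_from_nth _ x0).
  by rewrite size_delete !size_codom_ord.
rewrite size_codom_ord => k kn; rewrite (nth_codom_ord _ (Ordinal kn)).
by rewrite nth_delete -(nth_codom_ord x _ x0).
Qed.

Lemma codom_dfwith (T : Type) n (x : 'I_n -> T) (i : 'I_n) u :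
  codom (dfwith x i u) = take i (codom x) ++ u :: drop i.+1 (codom x).
Proof.
apply: (@eq_from_nth _ u).
  rewrite size_cat /= size_take size_drop !size_codom_ord ltn_ord.
  by rewrite subnSK // subnKC // ltnW.
rewrite size_codom_ord => k kn; rewrite (nth_codom_ord _ (Ordinal kn)) nth_cat.
rewrite size_take size_codom_ord ltn_ord.
have [->|ik] := eqVneq i (Ordinal kn); first by rewrite dfwithin ltnn subnn.
rewrite dfwithout //; case: ltngtP => [ki|ki|E].
- by rewrite nth_take // (nth_codom_ord x (Ordinal kn)).
- rewrite -[(k - i)%N]prednK ?subn_gt0 //= nth_drop -subnS subnKC //.
  by rewrite (nth_codom_ord x (Ordinal kn)).
- by case/eqP: ik; apply: val_inj.
Qed.

Section Expansion.
Variables (K : fieldType) (g : lieAlgType K) (M : lieModType g).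
Implicit Types (x y : g) (s : seq g) (w : seq g -> M).

Lemma ad_sum_expand x w s n : multilin w -> altern w -> size s = n ->
  ad_sum x w s = \sum_(k < n) (-1) ^+ k *: w (lie x s`_k :: delete k s).
Proof.
move=> + + <-; elim: s {n} w => [|y s IH] w wl wa /=; first by rewrite big_ord0.
rewrite big_ord_recl /= scale1r (IH _ (multilin_ins y wl) (altern_ins y wa)).
congr (_ + _); apply: eq_bigr => k _.
rewrite /bump /= add1n /= /ins (altern_swap [::]) // exprS mulN1r scaleNr.
by rewrite scalerN.
Qed.

(** The terms with [i = 0] form [L_x w] for the head [x], the others come from [- d iota_x w]. In
    the double sum shifting both indices preserves the sign, and the minus is absorbed by swapping
    [x] with the bracket. *)
Lemma ldiff_expand w s n : multilin w -> altern w -> size s = n ->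
  ldiff w s = \sum_(i < n) (-1) ^+ i *: lact s`_i (w (delete i s)) +
    \sum_(i < n) \sum_(j < n | (i < j)%N)
      (-1) ^+ (i + j) *: w (lie s`_i s`_j :: delete i (delete j s)).
Proof.
move=> + + <-; elim: s {n} w => [|x s IH] w wl wa /=.
  by rewrite !big_ord0 addr0.
rewrite !big_ord_recl /= scale1r (IH _ (multilin_ins x wl) (altern_ins x wa)).
rewrite /lie_der (@ad_sum_expand _ _ _ (size s)) // opprD addrACA -!addrA.
congr (_ + _).
congr (_ + _).
  rewrite -sumrN; apply: eq_bigr => i _.
  by rewrite /bump /= add1n add0n /= /ins exprS mulN1r scaleNr.
congr (_ + _).
  rewrite [RHS]big_mkcond big_ord_recl /= add0r -sumrN.
  apply: eq_bigr => i _.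
  by rewrite /bump /= add1n !add0n exprS mulN1r scaleNr.
rewrite -sumrN; apply: eq_bigr => i _.
rewrite [RHS]big_mkcond big_ord_recl /= add0r -big_mkcond -sumrN.
apply: eq_big => [k|k _]; rewrite /bump /= !add1n //.
rewrite addSn addnS exprS exprS !mulN1r opprK /= /ins.
by rewrite (altern_swap [::]) // scalerN opprK.
Qed.

Lemma codom_lie_contract n (x : 'I_n.+1 -> g) (i k : 'I_n.+1) : (i < k)%N ->
  codom (lie_contract x i k) = lie (x i) (x k) :: delete i (delete k (codom x)).
Proof.
move=> ik; have kn : (k <= n)%N by rewrite -ltnS.
have n0 : (0 < n)%N by exact: leq_trans (leq_ltn_trans (leq0n i) ik) kn.
have dk : size (delete k (codom x)) = n by rewrite size_delete size_codom_ord.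
have di : size (delete i (delete k (codom x))) = n.-1.
  by rewrite size_delete dk // (leq_trans ik).
apply: (@eq_from_nth _ 0); first by rewrite /= di size_codom_ord prednK.
rewrite size_codom_ord => m mn; rewrite (nth_codom_ord _ (Ordinal mn)).
rewrite /lie_contract /=.
case: m mn => //= m mn; rewrite !nth_delete.
have ble a b : (bump a b <= b.+1)%N by rewrite /bump -add1n leq_add2r leq_b1.
have bn : (bump k (bump i m) < n.+1)%N.
  by rewrite ltnS (leq_trans (ble _ _)) // (leq_ltn_trans (ble _ _)).
by rewrite -(nth_codom_ord x _ 0) inordK.
Qed.

Lemma ce_diff_codom n w (x : 'I_n.+1 -> g) : multilin w -> altern w ->
  ce_diff (fun y : 'I_n -> g => w (codom y)) x = ldiff w (codom x).
Proof.
move=> wl wa; rewrite (@ldiff_expand _ _ n.+1) ?size_codom_ord // /ce_diff.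
congr (_ + _); apply: eq_bigr => i _.
  by rewrite codom_lift nth_codom_ord.
by apply: eq_bigr => k ik; rewrite codom_lie_contract // !nth_codom_ord.
Qed.

Lemma altern_nuniq w s : multilin w -> altern w -> ~~ uniq s -> w s = 0.
Proof.
elim: s w => //= x s IH w wl wa; rewrite negb_and negbK.
have [xs _|_ /=] := boolP (x \in s); first exact: altern_mem2.
by move/(IH _ (multilin_ins x wl) (altern_ins x wa)).
Qed.

Lemma cochain_codom n w : multilin w -> altern w ->
  is_cochain (fun x : 'I_n -> g => w (codom x)).
Proof.
move=> wl wa; split=> [i x a u v|x i k ik xik]; first by rewrite !codom_dfwith.
apply: altern_nuniq => //; apply: contra ik => /injectiveP inj.
exact/eqP/inj.
Qed.

Lemma ad_sum_size x w s : (forall t, size t = size s -> w t = 0) -> ad_sum x w s = 0.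
Proof.
elim: s w => //= y s IH w w0; rewrite w0 // IH ?addr0 // => t ts.
by rewrite /ins w0 //= ts.
Qed.

Lemma ldiff_size w s : (forall t, (size t).+1 = size s -> w t = 0) -> ldiff w s = 0.
Proof.
elim: s w => //= x s IH w w0.
rewrite /lie_der w0 // ad_sum_size => [|t ts]; last by rewrite w0 // ts.
by rewrite lact0 IH ?subrr ?subr0 // => t ts; rewrite /ins w0 //= ts.
Qed.

(** The value 0 at all other lengths makes the cochain homogeneous, so that its [ldiff] can only be
    nonzero on lists of length [n.+1]. *)
Definition list_cochain n (z : ('I_n -> g) -> M) s : M :=
  if size s == n then z (fun i => s`_i) else 0.

Lemma list_cochain_codom n (z : ('I_n -> g) -> M) (x : 'I_n -> g) :
  list_cochain z (codom x) = z x.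
Proof.
rewrite /list_cochain size_codom_ord eqxx; congr z; apply/funext => i.
exact: nth_codom_ord.
Qed.

Lemma list_cochain_size n (z : ('I_n -> g) -> M) s :
  size s != n -> list_cochain z s = 0.
Proof. by rewrite /list_cochain => /negbTE ->. Qed.

Lemma multilin_list_cochain n (z : ('I_n -> g) -> M) :
  is_cochain z -> multilin (list_cochain z).
Proof.
move=> [zl _] s1 s2 a x y; rewrite /list_cochain !size_cat /=.
case: eqP => [sn|_]; last by rewrite scaler0 addr0.
have in_ : (size s1 < n)%N by rewrite -sn addnS ltnS leq_addr.
pose i := Ordinal in_.
(* The list becomes an update of a tuple at slot [i], as in the definition of [multilinear]; the 0
   is a placeholder that gets overwritten. *)
have E u : (fun k : 'I_n => (s1 ++ u :: s2)`_k) =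
    dfwith (fun k : 'I_n => (s1 ++ 0 :: s2)`_k) i u.
  apply/funext => k; have [<-|ik] := eqVneq i k.
    by rewrite dfwithin nth_cat ltnn subnn.
  rewrite dfwithout // !nth_cat; case: ltnP => // sk.
  have : (0 < k - size s1)%N by rewrite subn_gt0 ltn_neqAle sk andbT.
  by case: (k - size s1)%N.
by rewrite (E (_ + _)) (E x) (E y) zl.
Qed.

Lemma altern_list_cochain n (z : ('I_n -> g) -> M) :
  is_cochain z -> altern (list_cochain z).
Proof.
move=> [_ za] s1 s2 x; rewrite /list_cochain size_cat /=; case: eqP => // sn.
have i1 : (size s1 < n)%N by rewrite -sn addnS ltnS leq_addr.
have i2 : ((size s1).+1 < n)%N by rewrite -sn !addnS !ltnS leq_addr.
apply: (za _ (Ordinal i1) (Ordinal i2)); first by rewrite -val_eqE /= ltn_eqF.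
by rewrite /= !nth_cat ltnn subnn ltnNge leqnSn /= subSnn.
Qed.

Lemma ldiff_list_cochain n (z : ('I_n -> g) -> M) s :
  is_cocycle z -> ldiff (list_cochain z) s = 0.
Proof.
move=> [zc dz]; have [sn|sn] := eqVneq (size s) n.+1; last first.
  apply: ldiff_size => t ts; apply: list_cochain_size.
  by apply: contra sn => /eqP tn; rewrite -ts tn.
rewrite -(codom_nth 0 sn) -ce_diff_codom.
- by rewrite -[RHS](dz (fun i => s`_i)); congr ce_diff; apply/funext => y;
     exact: list_cochain_codom.
- exact: multilin_list_cochain.
- exact: altern_list_cochain.
Qed.

End Expansion.

(** * Ordered bases of complements *)

Section OrderedBasis.
Variables (K : fieldType) (h' h : lmodType K) (j : h' -> h).

Definition lin_ev C (V : lmodType K) (F : C -> V) (s : seq (K * C)) : V :=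
  \sum_(p <- s) p.1 *: F p.2.

(* A totally ordered basis [cb_vec] of a complement of [j h'] in [h].  The
   coordinates enter only through the linear extension [lin_ev F (cb_coord x)]
   of a family [F], which is why the axioms are stated for all [F]. *)
Record complement_basis := ComplementBasis {
  cb_index : eqType;
  cb_le : rel cb_index;
  cb_vec : cb_index -> h;
  cb_coord : h -> seq (K * cb_index);
  cb_proj : h -> h';
  cb_le_total : total cb_le;
  cb_le_trans : transitive cb_le;
  cb_le_anti : antisymmetric cb_le;
  cb_ext_linear : forall (V : lmodType K) (F : cb_index -> V),
    linear (fun x => lin_ev F (cb_coord x));
  cb_ext_vec : forall (V : lmodType K) (F : cb_index -> V) c,
    lin_ev F (cb_coord (cb_vec c)) = F c;
  cb_ext_sub : forall (V : lmodType K) (F : cb_index -> V) y,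
    lin_ev F (cb_coord (j y)) = 0;
  cb_decomp : forall x, x = j (cb_proj x) + lin_ev cb_vec (cb_coord x)
}.

Hypothesis j_lin : linear j.
Variable R : rel h.
Hypothesis R_wo : wochoice.well_order R.

Let R_total : total R.
Proof.
have W : wochoice.wo_chain R predT by move=> A _; exact: R_wo.
by move=> x y; apply: (wochoice.wo_chainW W).
Qed.

Let R_anti : antisymmetric R.
Proof.
have W : wochoice.wo_chain R predT by move=> A _; exact: R_wo.
by move=> x y; apply: (wochoice.wo_chain_antisymmetric W).
Qed.

Let R_trans : transitive R.
Proof.
move=> y x z xy yz.
(* Each case is settled by which of the three elements is the least. *)
have [|m [[]]] := R_wo (A := pred3 x y z); first by exists x; rewrite !inE eqxx.
rewrite !inE => /or3P[]/eqP-> mP _.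
- by apply: mP; rewrite !inE eqxx !orbT.
- suff -> : x = y by [].
  by apply: R_anti; rewrite xy mP ?inE ?eqxx.
- suff <- : y = z by [].
  by apply: R_anti; rewrite yz mP ?inE ?eqxx ?orbT.
Qed.

(** Membership in the span of the image of [j] and [A], as the intersection of all subspaces
    containing both. *)
Let inspan (A : h -> Prop) x := forall P : h -> Prop,
  (forall a x y, P x -> P y -> P (a *: x + y)) -> (forall y, P (j y)) ->
  (forall c, A c -> P c) -> P x.

(** Greedy choice of a basis along the well-order: a vector is kept when it is not spanned by the
    image of [j] and its predecessors. *)
Let basic : pred h := fun c => ~~ `[< inspan (fun b => R b c && (b != c)) c >].

Let inspan_lin A a x y : inspan A x -> inspan A y -> inspan A (a *: x + y).
Proof. by move=> Ax Ay P Pl Pj PA; apply: (Pl); [exact: Ax|exact: Ay]. Qed.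

(** A least vector outside the span would not be basic, hence would be spanned by the image of [j]
    and by predecessors, which lie in the span by minimality. *)
Let inspan_basic x : inspan basic x.
Proof.
apply: contrapT => nx.
have [|m [[mA mmin] _]] := R_wo (A := fun x => ~~ `[< inspan basic x >]).
  by exists x; apply/asboolP.
move/asboolP: mA; apply.
have [|/negPn/asboolP mb] := boolP (basic m).
  by move=> bm P Pl Pj; apply.
move=> P Pl Pj PA; apply: mb => // b /andP[bm]; apply: contraNP => nPb.
apply/eqP/R_anti; rewrite bm mmin //; apply/asboolP => bs.
by apply: nPb; exact: bs.
Qed.

Let C := {c : h | basic c}.
Let le (c d : C) := R (val c) (val d).

Let ev_scale (V : lmodType K) (F : C -> V) a s :
  lin_ev F [seq (a * p.1, p.2) | p <- s] = a *: lin_ev F s.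
Proof.
by rewrite /lin_ev big_map scaler_sumr; apply: eq_bigr => p _; rewrite scalerA.
Qed.

Let ev_cat (V : lmodType K) (F : C -> V) s t :
  lin_ev F (s ++ t) = lin_ev F s + lin_ev F t.
Proof. exact: big_cat. Qed.

Let spanP x : exists p : seq (K * C) * h', x = j p.2 + lin_ev val p.1.
Proof.
apply: (@inspan_basic x (fun x => exists p : seq (K * C) * h',
  x = j p.2 + lin_ev val p.1)).
- move=> a _ _ [[s y] ->] [[t z] ->].
  exists ([seq (a * p.1, p.2) | p <- s] ++ t, a *: y + z) => /=.
  by rewrite ev_cat ev_scale j_lin scalerDr addrACA.
- by move=> y; exists ([::], y); rewrite /lin_ev big_nil addr0.
- move=> c bc; exists ([:: (1, exist _ c bc)], 0).
  by rewrite /lin_ev big_seq1 /= scale1r (linear_fun0 j_lin) add0r.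
Qed.

Let coef (s : seq (K * C)) c : K := \sum_(p <- s | p.2 == c) p.1.

Let ev_coef (V : lmodType K) (F : C -> V) s (T : seq C) :
  uniq T -> {subset [seq p.2 | p <- s] <= T} ->
  lin_ev F s = \sum_(c <- T) coef s c *: F c.
Proof.
move=> uT sT; rewrite /lin_ev /coef.
under [RHS]eq_bigr do rewrite scaler_suml.
rewrite (exchange_big_dep xpredT) //=.
rewrite !big_seq; apply: eq_bigr => p ps.
rewrite -big_filter (_ : [seq c <- T | p.2 == c] = [:: p.2]) ?big_seq1 //.
have pT : p.2 \in T by apply/sT/map_f.
by rewrite (eq_filter (a2 := pred1 p.2)) ?filter_pred1_uniq // => c; rewrite /= eq_sym.
Qed.

(** The head of [T] is its largest letter. A nonzero coefficient there would put that letter in the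
    span of the image of [j] and smaller vectors, so it would not be basic. *)
Let free_sorted (a : C -> K) T y : uniq T -> sorted (fun c d => le d c) T ->
  j y + \sum_(c <- T) a c *: val c = 0 -> forall c, c \in T -> a c = 0.
Proof.
elim: T y => // c T IH y /= /andP[cT uT] pT; rewrite big_cons => jc.
have ac0 : a c = 0.
  apply/eqP/negP => /negP ac; have /negP := valP c; apply; apply/asboolP.
  set A := (A in inspan A _).
  have -> : val c = - (a c)^-1 *: (j y + \sum_(d <- T) a d *: val d) + j 0.
    rewrite (linear_fun0 j_lin) addr0.
    move/eqP: jc; rewrite addrCA addr_eq0 => /eqP/(congr1 (fun v => (a c)^-1 *: v)).
    by rewrite scalerA mulVf // scale1r scalerN scaleNr.
  apply: inspan_lin; last by move=> P _ Pj _.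
  have inj0 y0 : inspan A (j y0) by move=> P _ Pj _.
  rewrite addrC -[X in inspan _ (X + _)]scale1r; apply: inspan_lin => //.
  have cd d : d \in T -> le d c.
    have tr : transitive (fun c d => le d c).
      by move=> u v w vu uw; exact: R_trans uw vu.
    by move=> dT; have /allP := order_path_min tr pT; apply.
  rewrite big_seq; elim/big_rec: _ => [|d v dT IHv].
    by rewrite -(linear_fun0 j_lin).
  apply: inspan_lin => // P _ _; apply.
  rewrite /A; have := cd d dT; rewrite /le => ->; apply: contraNneq cT => dc.
  by rewrite -(val_inj dc).
move=> d; rewrite inE => /predU1P[->//|].
apply: (IH y) => //; first exact: path_sorted pT.
by rewrite ac0 scale0r add0r in jc.
Qed.

Let freeP s y : j y + lin_ev val s = 0 ->
  forall (V : lmodType K) (F : C -> V), lin_ev F s = 0.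
Proof.
pose T := sort (fun c d => le d c) (undup [seq p.2 | p <- s]) => E V F.
have uT : uniq T by rewrite sort_uniq undup_uniq.
have sT : {subset [seq p.2 | p <- s] <= T} by move=> c; rewrite mem_sort mem_undup.
rewrite (ev_coef _ uT sT) big_seq big1 // => c cT.
rewrite (free_sorted (y := y) (a := coef s) uT _ _ cT) ?scale0r //.
  by apply: sort_sorted => c1 c2; exact: R_total.
by rewrite -(ev_coef _ uT sT).
Qed.

Let coord x := (projT1 (cid (spanP x))).1.
Let proj x := (projT1 (cid (spanP x))).2.

Let decomp x : x = j (proj x) + lin_ev val (coord x).
Proof. by rewrite /proj /coord; case: cid. Qed.

(** [coord x] is merely a chosen list. Its difference with any other expression of [x] is a
    relation, which [freeP] kills under every family [F], so linear extensions do not see the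
    choice. *)
Let ev_uniq s x y (V : lmodType K) (F : C -> V) :
  x = j y + lin_ev val s -> lin_ev F (coord x) = lin_ev F s.
Proof.
move=> xE.
have := @freeP ([seq (-1 * p.1, p.2) | p <- coord x] ++ s) (y - proj x) _ V F.
rewrite !ev_cat !ev_scale !scaleN1r => E.
apply/esym/subr0_eq; rewrite addrC E //.
by rewrite (linear_funB j_lin) [X in _ + X]addrC addrACA -xE -opprD -decomp subrr.
Qed.

Lemma wo_complement_basis : complement_basis.
Proof.
apply: (@ComplementBasis C le val coord proj) => //.
- by move=> c d; exact: R_total.
- by move=> c d e; exact: R_trans.
- by move=> c d /R_anti/val_inj.
- move=> V F a x y.
  rewrite (@ev_uniq ([seq (a * p.1, p.2) | p <- coord x] ++ coord y) _
     (a *: proj x + proj y)) ?ev_cat ?ev_scale //.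
  by rewrite j_lin addrACA -scalerDr -!decomp.
- move=> V F c; rewrite (@ev_uniq [:: (1, c)] _ 0) /lin_ev big_seq1 ?scale1r //.
  by rewrite (linear_fun0 j_lin) add0r.
- move=> V F y; rewrite (@ev_uniq [::] _ y) /lin_ev big_nil // addr0.
  by [].
Qed.

End OrderedBasis.

(** * The coinduced module *)

Section Coinduced.
Variables (K : fieldType) (h' h : lieAlgType K) (j : lieHom h' h).
Hypothesis j_inj : injective j.
Variable cb : complement_basis j.
Variable M : lieModType h'.

Local Notation C := (cb_index cb).
Local Notation le := (@cb_le _ _ _ _ cb).
Local Notation e := (@cb_vec _ _ _ _ cb).
Local Notation pi := (@cb_proj _ _ _ _ cb).

Let j_lin : linear j. Proof. exact: linearP. Qed.

Let cle_total : total le := @cb_le_total _ _ _ _ cb.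
Let cle_trans : transitive le := @cb_le_trans _ _ _ _ cb.
Let cle_anti : antisymmetric le := @cb_le_anti _ _ _ _ cb.

Definition lin_ext (V : lmodType K) (F : C -> V) (x : h) : V :=
  lin_ev F (cb_coord cb x).

Lemma lin_ext_linear (V : lmodType K) F : linear (@lin_ext V F).
Proof. exact: cb_ext_linear. Qed.

Lemma lin_ext_vec (V : lmodType K) F c : @lin_ext V F (e c) = F c.
Proof. exact: cb_ext_vec. Qed.

Lemma lin_ext_sub (V : lmodType K) F y : @lin_ext V F (j y) = 0.
Proof. exact: cb_ext_sub. Qed.

Lemma lin_ext_ext (V : lmodType K) (F G : C -> V) x :
  F =1 G -> lin_ext F x = lin_ext G x.
Proof. by move=> FG; apply: eq_bigr => p _; rewrite FG. Qed.

Lemma lin_ext_comb (V : lmodType K) a (F G : C -> V) x :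
  lin_ext (fun c => a *: F c + G c) x = a *: lin_ext F x + lin_ext G x.
Proof.
rewrite /lin_ext /lin_ev scaler_sumr -big_split; apply: eq_bigr => p _.
by rewrite scalerDr !scalerA mulrC.
Qed.

Lemma lin_eq0 (V : lmodType K) (G : h -> V) : linear G ->
  (forall y, G (j y) = 0) -> (forall c, G (e c) = 0) -> forall x, G x = 0.
Proof.
move=> Gl Gj Ge x; rewrite (cb_decomp cb x) (linear_funD Gl) Gj add0r.
rewrite /lin_ev; elim/big_rec: _ => [|p v _ IH]; first exact: linear_fun0.
by rewrite Gl Ge IH scaler0 addr0.
Qed.

Lemma lin_eq (V : lmodType K) (G1 G2 : h -> V) : linear G1 -> linear G2 ->
  (forall y, G1 (j y) = G2 (j y)) -> (forall c, G1 (e c) = G2 (e c)) -> G1 =1 G2.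
Proof.
move=> l1 l2 Ej Ee x; apply/subr0_eq.
apply: (@lin_eq0 V (fun x => G1 x - G2 x)) => [|y|c].
- exact: linear_comb_sub.
- by rewrite Ej subrr.
- by rewrite Ee subrr.
Qed.

Lemma proj_linear : linear pi.
Proof.
move=> a x y; apply: j_inj; apply: (@addIr _ (lin_ext e (a *: x + y))).
rewrite -cb_decomp j_lin lin_ext_linear addrACA -scalerDr.
by rewrite -!cb_decomp.
Qed.

Lemma proj_sub y : pi (j y) = y.
Proof.
by apply: j_inj; rewrite {2}(cb_decomp cb (j y)) cb_ext_sub addr0.
Qed.

Lemma proj_vec c : pi (e c) = 0.
Proof.
apply: j_inj; rewrite (linear_fun0 j_lin); apply: (@addIr _ (e c)).
by rewrite add0r {3}(cb_decomp cb (e c)) cb_ext_vec.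
Qed.

(** The projection of [h] onto the span of [j h'] and the basis vectors strictly below [c], killing
    the other basis vectors; thus [below c x = x] says that [x] lies below [c]. *)
Definition below c x : h := j (pi x) + lin_ext (fun b => if le c b then 0 else e b) x.

Lemma below_linear c : linear (below c).
Proof.
move=> a x y; rewrite /below proj_linear j_lin lin_ext_linear scalerDr.
by rewrite addrACA.
Qed.

Lemma below_sub c y : below c (j y) = j y.
Proof. by rewrite /below lin_ext_sub addr0 proj_sub. Qed.

Lemma below_vec c b : below c (e b) = if le c b then 0 else e b.
Proof. by rewrite /below lin_ext_vec proj_vec (linear_fun0 j_lin) add0r. Qed.

Lemma lin_ext_below (V : lmodType K) (F : C -> V) c x :
  lin_ext F (below c x) = lin_ext (fun b => if le c b then 0 else F b) x.
Proof.
apply: (@lin_eq _ (fun x => lin_ext F (below c x))) => [a y z||y|b].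
- by rewrite below_linear lin_ext_linear.
- exact: lin_ext_linear.
- by rewrite below_sub !lin_ext_sub.
- rewrite below_vec lin_ext_vec; case: ifP => _; last by rewrite lin_ext_vec.
  exact: linear_fun0 (lin_ext_linear _).
Qed.

Definition dominates c (w : seq C) := if w is d :: _ then le d c else true.

Definition descending (w : seq C) := sorted (fun c d => le d c) w.

Lemma descending_cons c w : descending (c :: w) -> dominates c w /\ descending w.
Proof. by case: w => //= d w /andP[]. Qed.

Fixpoint insert b (w : seq C) : seq C :=
  if w is c :: v then if le c b then b :: w else c :: insert b v else [:: b].

Lemma size_insert b w : size (insert b w) = (size w).+1.
Proof. by elim: w => //= c v IH; case: ifP => //= _; rewrite IH. Qed.

Lemma insert_dominated b w : dominates b w -> insert b w = b :: w.
Proof. by case: w => //= c v ->. Qed.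

Lemma dominates_insert c b w : dominates c w -> ~~ le c b -> dominates c (insert b w).
Proof.
move=> cw ncb; case: w cw => /= [_|d v dc].
  by have := cle_total b c; rewrite (negbTE ncb) orbF.
case: ifP => //= _.
by have := cle_total b c; rewrite (negbTE ncb) orbF.
Qed.

Lemma descending_insert b w : descending w -> descending (insert b w).
Proof.
elim: w => //= c v IH cv; case: ifP => /= [cb'|ncb]; first by rewrite cb'.
have [cd dv] := descending_cons cv; have := dominates_insert cd (negbT ncb).
have := IH dv; rewrite /descending; case: (insert b v) => //= d u -> /= ->.
by [].
Qed.

(* By Poincare-Birkhoff-Witt, U(h')-linear maps U(h) -> M correspond to functions
   on ordered words in the basis, and [x] acts by [psi |-> psi (_ * x)].  Words
   are stored reversed, so that the head is the rightmost and largest letter.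
   [word_act] straightens the product of [w] and [x]: the leading terms insert a
   letter into [w], and [act_low], whose fuel [n] bounds the length of [w],
   comes from v c x = (v x) c + v [c, x] when [x] lies below [c]. *)
Fixpoint act_low n (x : h) (psi : seq C -> M) (w : seq C) : M :=
  match w with
  | [::] => lact (pi x) (psi [::])
  | c :: v => if n is p.+1 then
      act_low p (below c x)
        (fun u => lin_ext (fun b => psi (insert b u)) (e c) + act_low p (e c) psi u) v
      + (lin_ext (fun b => psi (insert b v)) (lie (e c) (below c x))
         + act_low p (lie (e c) (below c x)) psi v)
    else 0
  end.

Definition word_act x psi w : M :=
  lin_ext (fun b => psi (insert b w)) x + act_low (size w) x psi w.

(** Every insertion of a letter follows the removal of one, so only words no longer than [w] are
    read, and fuel beyond the length of [w] changes nothing. *)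
Lemma act_low_ext n m x psi1 psi2 w : (size w <= n)%N -> (size w <= m)%N ->
  descending w ->
  (forall u, descending u -> (size u <= size w)%N -> psi1 u = psi2 u) ->
  act_low n x psi1 w = act_low m x psi2 w.
Proof.
elim: n m x psi1 psi2 w => [|n IH] m x psi1 psi2 [|c v] //=.
- by move=> _ _ _ E; case: m => [|m] /=; rewrite E.
- by move=> _ _ _ E; case: m => [|m] /=; rewrite E.
case: m => // m; rewrite !ltnS => vn vm /descending_cons[_ dv] E.
have low u y : descending u -> (size u <= size v)%N ->
    act_low n y psi1 u = act_low m y psi2 u.
  move=> du uv; apply: IH => //; try exact: leq_trans uv _.
  by move=> t dt tu; apply: E; rewrite ?(leq_trans tu (leq_trans uv _)).
have top u y : descending u -> (size u <= size v)%N ->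
    lin_ext (fun b => psi1 (insert b u)) y = lin_ext (fun b => psi2 (insert b u)) y.
  move=> du uv; apply: lin_ext_ext => b; apply: E; first exact: descending_insert.
  by rewrite size_insert.
congr (_ + (_ + _)); [|exact: top|exact: low].
by apply: IH => // u du uv; rewrite top ?low.
Qed.

Lemma word_act_ext x psi1 psi2 w : descending w ->
  (forall u, descending u -> (size u <= (size w).+1)%N -> psi1 u = psi2 u) ->
  word_act x psi1 w = word_act x psi2 w.
Proof.
move=> dw E; congr (_ + _).
  apply: lin_ext_ext => b; apply: E; first exact: descending_insert.
  by rewrite size_insert.
by apply: act_low_ext => // u du uw; rewrite E // ltnW.
Qed.

Lemma word_act_nil x psi :
  word_act x psi [::] = lin_ext (fun b => psi [:: b]) x + lact (pi x) (psi [::]).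
Proof. by []. Qed.

Lemma act_low_cons x psi c v : descending v ->
  act_low (size v).+1 x psi (c :: v) =
  act_low (size v) (below c x) (word_act (e c) psi) v
  + word_act (lie (e c) (below c x)) psi v.
Proof.
move=> dv /=; congr (_ + _); apply: act_low_ext => // u du uv.
by congr (_ + _); exact: act_low_ext.
Qed.

(** The only longer words that are read come from the leading terms, and these insert letters below
    [c] when [x] lies below [c]. *)
Lemma word_act_ext_below c x psi1 psi2 w : descending w -> below c x = x ->
  (forall u, descending u -> (size u <= size w)%N -> psi1 u = psi2 u) ->
  (forall b, ~~ le c b -> psi1 (insert b w) = psi2 (insert b w)) ->
  word_act x psi1 w = word_act x psi2 w.
Proof.
move=> dw xc E Ec; congr (_ + _); last exact: act_low_ext.
rewrite -xc !lin_ext_below; apply: lin_ext_ext => b.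
by case: ifPn => // /Ec.
Qed.

Lemma act_low_linearl n psi w : linear (fun x => act_low n x psi w).
Proof.
elim: n psi w => [|n IH] psi [|c v] a x y /=; rewrite ?proj_linear ?lact_linearl //.
  by rewrite scaler0 addr0.
rewrite below_linear lie_linearr !IH lin_ext_linear !scalerDr.
by rewrite [X in _ + X = _]addrACA [LHS]addrACA.
Qed.

Lemma act_low_linearr n x a psi1 psi2 w :
  act_low n x (fun u => a *: psi1 u + psi2 u) w =
  a *: act_low n x psi1 w + act_low n x psi2 w.
Proof.
elim: n x psi1 psi2 w => [|n IH] x psi1 psi2 [|c v] /=; rewrite ?lact_linearr //.
  by rewrite scaler0 addr0.
rewrite lin_ext_comb IH !scalerDr.
have E : (fun u => lin_ext (fun b => a *: psi1 (insert b u) + psi2 (insert b u)) (e c)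
      + act_low n (e c) (fun u0 => a *: psi1 u0 + psi2 u0) u) =
    (fun u => a *: (lin_ext (fun b => psi1 (insert b u)) (e c) + act_low n (e c) psi1 u)
      + (lin_ext (fun b => psi2 (insert b u)) (e c) + act_low n (e c) psi2 u)).
  by apply/funext => u; rewrite lin_ext_comb IH scalerDr addrACA.
rewrite E IH.
by rewrite [X in _ + X = _]addrACA [LHS]addrACA.
Qed.

Lemma word_act_linearl psi w : linear (fun x => word_act x psi w).
Proof.
move=> a x y; rewrite /word_act lin_ext_linear act_low_linearl scalerDr.
by rewrite addrACA.
Qed.

Lemma word_act_linearr x a psi1 psi2 w :
  word_act x (fun u => a *: psi1 u + psi2 u) w =
  a *: word_act x psi1 w + word_act x psi2 w.
Proof.
by rewrite /word_act lin_ext_comb act_low_linearr scalerDr addrACA.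
Qed.

Lemma word_act_comp_linear x psi w : linear (fun y => word_act x (word_act y psi) w).
Proof.
move=> a y z; rewrite -word_act_linearr; congr (word_act _ _ w).
by apply/funext => u; exact: word_act_linearl.
Qed.

(** The product of [v] and [e c] is already ordered: the correction terms vanish because [below d]
    kills [e c] for the head [d] of [v]. *)
Lemma word_act_dominating c psi v : descending v -> dominates c v ->
  word_act (e c) psi v = psi (c :: v).
Proof.
move=> dv cv; rewrite /word_act lin_ext_vec insert_dominated //.
case: v dv cv => [_ _|d v dv /= dc].
  by rewrite /= proj_vec (linear_fun0 (lact_linearl _)) addr0.
have [_ {}dv] := descending_cons dv.
rewrite below_vec dc (linear_fun0 (lie_linearr _)).
rewrite !(linear_fun0 (act_low_linearl _ _ _)) (linear_fun0 (lin_ext_linear _)).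
by rewrite !addr0.
Qed.

(** The leading terms agree because a letter below [c] is inserted behind the head [c]. *)
Lemma word_act_below c x psi v : descending v -> dominates c v -> below c x = x ->
  word_act x psi (c :: v) =
  word_act x (word_act (e c) psi) v + word_act (lie (e c) x) psi v.
Proof.
move=> dv cv xc; rewrite {1}/word_act act_low_cons // xc addrA; congr (_ + _ + _).
rewrite -xc !lin_ext_below; apply: lin_ext_ext => b.
case: ifPn => // ncb.
rewrite word_act_dominating ?dominates_insert ?descending_insert //=.
by rewrite (negbTE ncb).
Qed.

(** For [x] below [c] this is the straightening rule. For a letter [b] strictly above [c] it is the
    same rule with [b] and [c] exchanged, as [b] dominates [v] too. *)
Lemma word_act_lie_dominating c x psi v : descending v -> dominates c v ->
  word_act (e c) (word_act x psi) v =
  word_act x (word_act (e c) psi) v + word_act (lie (e c) x) psi v.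
Proof.
move=> dv cv.
have low y : below c y = y -> word_act (e c) (word_act y psi) v =
    word_act y (word_act (e c) psi) v + word_act (lie (e c) y) psi v.
  by move=> yc; rewrite word_act_dominating // word_act_below.
move: x; apply: lin_eq => [|a x y|y|b].
- exact: word_act_comp_linear.
- by rewrite lie_linearr !word_act_linearl addrACA -scalerDr.
- by apply: low; rewrite below_sub.
have [cb'|ncb] := boolP (le c b); last by apply: low; rewrite below_vec (negbTE ncb).
have [->|bc] := eqVneq b c.
  by rewrite lie_alt (linear_fun0 (word_act_linearl _ _)) addr0.
have nbc : ~~ le b c.
  by apply: contra_neqN bc => bc; apply: cle_anti; rewrite bc cb'.
have bv : dominates b v.
  by case: v cv {dv low} => //= d v dc; exact: cle_trans dc cb'.
rewrite [X in _ = X + _]word_act_dominating // word_act_below //.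
  rewrite (lieC (e c)) (linear_funN (word_act_linearl _ _)) addrK.
  by [].
by rewrite below_vec (negbTE nbc).
Qed.

(** Induction on the length of [w]. A letter dominating [w] is covered by the previous lemma. Two
    low arguments are moved past the head [c], which leaves shorter words and the Jacobi identity;
    at the empty word the module axiom of [M] remains. *)
Lemma word_act_lie x y psi w : descending w ->
  word_act (lie x y) psi w =
  word_act x (word_act y psi) w - word_act y (word_act x psi) w.
Proof.
have [n] := ubnP (size w); elim: n x y psi w => // n IH x y psi w wn dw.
pose D x y := word_act (lie x y) psi w -
  (word_act x (word_act y psi) w - word_act y (word_act x psi) w).
have Dl z : linear (D^~ z).
  apply: linear_comb_sub => [a u v|].
    by rewrite lie_linearl word_act_linearl.
  by apply: linear_comb_sub; [exact: word_act_linearl|exact: word_act_comp_linear].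
have DC u v : D u v = - D v u.
  by rewrite /D lieC (linear_funN (word_act_linearl _ _)) opprB opprB addrC.
suff D0 : D x y = 0 by apply: subr0_eq.
have top b v : dominates b w -> D (e b) v = 0.
  move=> bw; rewrite /D word_act_lie_dominating // [X in _ - X]addrAC.
  by rewrite subrr add0r subrr.
(* Every letter dominates [w] or is fixed by [low], and so is every [j y]; bilinearity then leaves
   the case of two arguments fixed by [low]. *)
pose low z := if w is c :: _ then below c z else j (pi z).
have low_sub z : low (j z) = j z.
  by rewrite /low; case: (w) => [|c v]; rewrite ?proj_sub ?below_sub.
have low_vec b : ~~ dominates b w -> low (e b) = e b.
  rewrite /low; case: (w) => //= c v cb'; rewrite below_vec ifN //.
suff low0 u v : low u = u -> low v = v -> D u v = 0.
  have E z c : D z (e c) = 0.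
    have [cw|/low_vec ec] := boolP (dominates c w); first by rewrite DC top ?oppr0.
    move: z; apply: (lin_eq0 (Dl _)) => [y1|b]; first exact: low0.
    by have [/top//|/low_vec] := boolP (dominates b w); move/low0; apply.
  move: x; apply: (lin_eq0 (Dl _)) => [y'|b]; last by rewrite DC E oppr0.
  rewrite DC -oppr0; congr (- _).
  move: y; apply: (lin_eq0 (Dl _)) => [y1|b]; first exact: low0.
  by rewrite DC E oppr0.
rewrite /low /D {low low_sub low_vec top DC Dl D}.
case: w dw wn => [|c w] dw wn uE vE.
  rewrite -uE -vE -lie_morphM !word_act_nil !lin_ext_sub !add0r !proj_sub.
  by rewrite lact_lie subrr.
have [cw {}dw] := descending_cons dw; move: wn; rewrite ltnS => wn.
(* Inside the outer action, [e c] is commuted past [v1] by induction at words no longer than [w],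
   and by the dominating case at insertions of a letter below [c]. *)
have step u1 v1 : below c u1 = u1 -> below c v1 = v1 ->
  word_act u1 (word_act v1 psi) (c :: w) =
    word_act u1 (word_act v1 (word_act (e c) psi)) w
    + word_act u1 (word_act (lie (e c) v1) psi) w
    + word_act (lie (e c) u1) (word_act v1 psi) w.
  move=> u1c v1c; rewrite word_act_below //; congr (_ + _).
  rewrite -[word_act u1 (word_act v1 _) w]scale1r -word_act_linearr.
  apply: (word_act_ext_below dw u1c) => [t dt tw|b ncb].
    rewrite scale1r [in RHS]IH ?(leq_ltn_trans tw) //.
    by rewrite [RHS]addrC subrK.
  rewrite scale1r word_act_lie_dominating ?descending_insert //.
  exact: dominates_insert.
rewrite !step //.
have ec z : word_act z psi (c :: w) = word_act z (word_act (e c) psi) w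
  + word_act (lie (e c) z) psi w.
  by rewrite -word_act_lie_dominating // word_act_dominating.
have jac : word_act (lie (e c) (lie u v)) psi w =
    word_act (lie (lie (e c) u) v) psi w + word_act (lie u (lie (e c) v)) psi w.
  by rewrite -(linear_funD (word_act_linearl _ _)) lie_lie subrK.
rewrite ec jac (IH u v) // (IH (lie _ u) v) // (IH u (lie _ v)) //.
move: (word_act u _ w) (word_act v _ w) (word_act u _ w) (word_act (lie _ v) _ w).
move: (word_act v _ w) (word_act (lie _ u) _ w) => p q r s t v'.
apply/eqP; rewrite subr_eq0 !opprD [q - p + _]addrACA [t - s + _]addrACA.
by rewrite -!addrA [r + (q + _)]addrCA.
Qed.

Definition coinduced : Type := seq C -> M.

HB.instance Definition _ := GRing.Lmodule.copy coinduced (seq C -> M).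

(* Only descending words are meaningful; the action is 0 on the other ones, so
   that the module axioms hold there too. *)
Definition coind_act (x : h) (psi : coinduced) : coinduced :=
  fun w => if descending w then word_act x psi w else 0.

Fact coind_act_linearl psi : linear (coind_act^~ psi).
Proof.
move=> a x y; apply/funext => w; rewrite /coind_act [RHS]/GRing.add /=.
rewrite [in RHS]/GRing.scale /=.
by case: ifP => _; rewrite ?word_act_linearl ?scaler0 ?addr0.
Qed.

Fact coind_act_linearr x : linear (coind_act x).
Proof.
move=> a psi1 psi2; apply/funext => w; rewrite /coind_act [RHS]/GRing.add /=.
rewrite [in RHS]/GRing.scale /=.
by case: ifP => _; rewrite -?word_act_linearr ?scaler0 ?addr0.
Qed.

Fact coind_act_lie x y psi :
  coind_act (lie x y) psi =
  coind_act x (coind_act y psi) - coind_act y (coind_act x psi).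
Proof.
apply/funext => w; rewrite [RHS]/GRing.add /= [in RHS]/GRing.opp /=.
rewrite /coind_act; case: ifP => dw; last by rewrite subrr.
rewrite word_act_lie //; congr (_ - _).
  by apply: word_act_ext => // u du _; rewrite du.
by apply: word_act_ext => // u du _; rewrite du.
Qed.

HB.instance Definition _ := Lmodule_isLieModule.Build K h coinduced
  coind_act_linearl coind_act_linearr coind_act_lie.

Lemma coind_actE x (psi : coinduced) w : lact x psi w = coind_act x psi w.
Proof. by []. Qed.

(** * Extension of cocycles *)

Local Notation N := coinduced.

Lemma coindE (a : K) (f g : N) w : (a *: f + g) w = a *: f w + g w.
Proof. by []. Qed.

Lemma coindB (f g : N) w : (f - g) w = f w - g w.
Proof. by []. Qed.

Lemma multilin_eval (F : seq h -> N) :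
  multilin F <-> forall w, multilin (fun s => F s w).
Proof.
split=> [Fl w s1 s2 a x y|Fl s1 s2 a x y]; first by rewrite Fl.
by apply/funext => w; rewrite coindE; exact: Fl.
Qed.

Lemma altern_eval (F : seq h -> N) : altern F <-> forall w, altern (fun s => F s w).
Proof.
split=> [Fa w s1 s2 x|Fa s1 s2 x]; first by rewrite Fa.
by apply/funext => w; exact: Fa.
Qed.

(** [ad_sum] does not involve the action, so it can be computed at a fixed word. *)
Lemma ad_sum_eval x (F G : seq h -> N) s w :
  (forall t, F t w = G t w) -> ad_sum x F s w = ad_sum x G s w.
Proof.
elim: s F G => //= y s IH F G FG.
rewrite -[LHS]/(F _ w + ad_sum x (ins F y) s w) FG (IH _ (ins G y)) // => t.
exact: FG.
Qed.

Lemma ad_sum_vanish x (F : seq h -> N) s w :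
  (forall t, F t w = 0) -> ad_sum x F s w = 0.
Proof.
by move=> F0; rewrite (ad_sum_eval _ _ (G := fun=> 0)) // ad_sum0.
Qed.

Lemma ldiff_consE x s (F : seq h -> N) w :
  ldiff F (x :: s) w = coind_act x (F s) w - ad_sum x F s w - ldiff (ins F x) s w.
Proof. by []. Qed.

Lemma ldiff_nondescending (F : seq h -> N) s w :
  ~~ descending w -> (forall t, F t w = 0) -> ldiff F s w = 0.
Proof.
move=> ndw; elim: s F => // x s IH F F0.
rewrite ldiff_consE ad_sum_vanish // IH => [|t]; last exact: F0.
by rewrite /coind_act (negbTE ndw) !subr0.
Qed.

Lemma word_act0 x w : word_act x (fun=> 0) w = 0.
Proof.
have := word_act_linearr x (-1) (fun=> 0) (fun=> 0) w.
under [X in word_act x X]eq_fun do rewrite scaler0 addr0.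
by rewrite scaleN1r addNr.
Qed.

(** Acting at [w] by arguments below [m] reads [F] only at words no longer than [w] and at
    insertions of letters below [m]. *)
Lemma ldiff_vanish m (F : seq h -> N) s w :
  all (fun x => below m x == x) s ->
  (forall t u, (size u <= size w)%N -> F t u = 0) ->
  (forall t b, all (fun x => below m x == x) t -> ~~ le m b -> F t (insert b w) = 0) ->
  ldiff F s w = 0.
Proof.
have [dw|ndw] := boolP (descending w); last first.
  by move=> _ F0 _; apply: ldiff_nondescending => // t; exact: F0.
elim: s F => // x s IH F /andP[/eqP xm sm] F0 Fi.
rewrite ldiff_consE ad_sum_vanish => [|t]; last exact: F0.
rewrite IH // => [|t u|t b tm]; [|exact: F0|by apply: Fi => /=; rewrite xm eqxx].
rewrite !subr0 /coind_act dw -[RHS](word_act0 x w).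
by apply: (word_act_ext_below dw xm) => [u _ /F0|b mb]; [exact|exact: Fi].
Qed.

(** Evaluation at the empty word is [h']-linear, hence commutes with the differentials. *)
Lemma ldiff_restrict (F : seq h -> N) (F' : seq h' -> M) s :
  (forall t, F (map j t) [::] = F' t) -> ldiff F (map j s) [::] = ldiff F' s.
Proof.
elim: s F F' => //= x s IH F F' FF'.
rewrite -[LHS]/(coind_act (j x) (F (map j s)) [::] - ad_sum (j x) F (map j s) [::]
  - ldiff (ins F (j x)) (map j s) [::]).
rewrite (IH _ (ins F' x)) => [|t]; last exact: (FF' (x :: t)).
congr (_ - _ - _).
  by rewrite /coind_act /= word_act_nil lin_ext_sub add0r proj_sub FF'.
elim: s {IH} F F' FF' => //= y s IH F F' FF'.
rewrite -[LHS]/(F _ [::] + ad_sum (j x) (ins F (j y)) (map j s) [::]).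
rewrite -lie_morphM (FF' (_ :: _)) (IH _ (ins F' y)) // => t.
exact: (FF' (y :: t)).
Qed.

Lemma max_index c (D : seq C) :
  exists2 m, m \in c :: D & forall d, d \in c :: D -> le d m.
Proof.
have refl d : le d d by have := cle_total d d; rewrite orbb.
elim: D c => [|b D IH] c.
  by exists c; rewrite ?mem_head // => d; rewrite inE => /eqP->.
have [m mD mmax] := IH b.
have [cm|mc] := orP (cle_total c m).
  exists m; first by rewrite inE mD orbT.
  by move=> d; rewrite inE => /predU1P[->|/mmax].
exists c; first exact: mem_head.
move=> d; rewrite inE => /predU1P[->|/mmax dm]; first exact: refl.
exact: cle_trans dm mc.
Qed.

Definition letter (l : h' + C) : h := match l with inl y => j y | inr c => e c end.

Lemma multilin_letters (Y : seq h -> M) : multilin Y ->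
  (forall L, Y (map letter L) = 0) -> forall X, Y X = 0.
Proof.
move=> Yl Y0 X; suff E L : Y (map letter L ++ X) = 0 by exact: (E [::]).
elim: X L => [|x X IH] L; first by rewrite cats0.
move: x; apply: (lin_eq0 (multilin_linear _ _ Yl)) => [y|c].
  by rewrite -cat_rcons -(map_rcons letter _ (inl y)).
by rewrite -cat_rcons -(map_rcons letter _ (inr c)).
Qed.

(** It suffices to test lists of letters. If some letter from the basis dominates [w], the largest
    such [m] is moved to the front; it then occurs twice, or all other arguments lie below it. *)
Lemma altern_letters (Y : seq h -> M) w : multilin Y -> altern Y ->
  (forall m s, dominates m w -> all (fun x => below m x == x) s -> Y (e m :: s) = 0) ->
  (forall s, all (fun x => (if w is c :: _ then below c x else j (pi x)) == x) s ->
    Y s = 0) ->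
  forall X, Y X = 0.
Proof.
move=> Yl Ya Ydom Ylow; apply: multilin_letters => // L.
pose index (l : h' + C) : option C := if l is inr c then Some c else None.
pose D := [seq c <- pmap index L | dominates c w].
have memD c : (c \in D) = (inr c \in L) && dominates c w.
  rewrite /D mem_filter mem_pmap andbC; congr (_ && _).
  by apply/mapP/idP => [[[y|d] dL //= [->]]|cL] //; exists (inr c).
case ED: D => [|c D'].
  apply: Ylow; rewrite all_map; apply/allP => -[y|c] cL /=.
    by case: (w) => [|c v]; rewrite ?proj_sub ?below_sub.
  have := memD c; rewrite ED cL /= => /esym.
  by case: (w) => //= d v dc; rewrite below_vec dc.
have [m mD mmax] := max_index c D'; rewrite -ED in mD mmax.
move: mD; rewrite memD => /andP[mL mw].
(* A letter not dominating [w] lies below the head of [w], hence below [m]. *)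
have maxL d : inr d \in L -> le d m.
  move=> dL; have [dw|] := boolP (dominates d w).
    by apply: mmax; rewrite memD dL.
  case: (w) mw => //= b v bm; have := cle_total b d => /orP[->//|db] _.
  exact: cle_trans db bm.
have [L1 [L2 LE]] : exists L1 L2, L = L1 ++ inr m :: L2.
  by case/splitPr: mL => L1 L2; exists L1, L2.
rewrite LE map_cat /= altern_front //.
have [mL'|mL'] := boolP (inr m \in L1 ++ L2).
  by rewrite -map_cat altern_mem2 ?scaler0 //; apply/mapP; exists (inr m).
rewrite -map_cat Ydom ?scaler0 // all_map; apply/allP => -[y|d] dL /=.
  by rewrite below_sub.
rewrite below_vec ifN //; apply: contraNN mL' => md.
suff -> : m = d by [].
apply: cle_anti; rewrite md maxL // LE mem_cat inE orbCA -mem_cat dL.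
by rewrite orbT.
Qed.

Section CocycleExtension.
Variable z' : seq h' -> M.
Hypothesis z'_lin : multilin z'.
Hypothesis z'_alt : altern z'.
Hypothesis z'_closed : forall s, ldiff z' s = 0.

(* [ext_upto k] is determined on words of length at most [k], and 0 on longer
   ones.  Its value at [m :: v] solves [ldiff z (e m :: s) v = 0] for [s] below
   [m], and vanishes as soon as an argument is a basis vector [>= m]. *)
Fixpoint ext_upto k (s : seq h) : N := fun w =>
  if k is p.+1 then
    if (size w <= p)%N then ext_upto p s w else
    if w is m :: v then
      if (size v == p) && descending w then
        let t := map (below m) s in
        ad_sum (e m) (ext_upto p) t v + ldiff (ins (ext_upto p) (e m)) t v
      else 0
    else 0
  else if w is [::] then z' (map pi s) else 0.

Definition ext_cocycle (s : seq h) : N := fun w => ext_upto (size w) s w.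

Lemma ext_upto_gt k s w : (k < size w)%N -> ext_upto k s w = 0.
Proof.
case: k => [|k]; case: w => //= m v kv.
by rewrite ltnNge ltnW //= ifF // gtn_eqF.
Qed.

Lemma ext_upto_le k s w : (size w <= k)%N -> ext_upto k s w = ext_cocycle s w.
Proof.
elim: k => [|k IH]; first by rewrite leqn0 /ext_cocycle => /eqP->.
rewrite leq_eqVlt => /predU1P[<-//|wk]; rewrite -IH //=.
by rewrite -ltnS wk.
Qed.

Lemma ext_cocycle_nil s : ext_cocycle s [::] = z' (map pi s).
Proof. by []. Qed.

Lemma ext_cocycle_cons s m v : descending (m :: v) ->
  ext_cocycle s (m :: v) = ad_sum (e m) (ext_upto (size v)) (map (below m) s) v
    + ldiff (ins (ext_upto (size v)) (e m)) (map (below m) s) v.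
Proof. by move=> dw; rewrite /ext_cocycle /= ltnn eqxx (dw : path _ m v). Qed.

Lemma ext_cocycle_nondescending s w : ~~ descending w -> ext_cocycle s w = 0.
Proof.
case: w => // m v ndw.
by rewrite /ext_cocycle /= ltnn eqxx (negbTE (ndw : ~~ path _ m v)).
Qed.

Lemma multilin_ext_upto k : multilin (ext_upto k).
Proof.
apply/multilin_eval; elim: k => [|k IH] w.
  case: w => [|c w] /=; first exact: multilin_comp proj_linear z'_lin.
  exact: multilin0.
rewrite /=; case: (size w <= k)%N; first exact: IH.
case: w => [|m v]; first exact: multilin0.
case: (_ && _); last exact: multilin0.
have El := (multilin_eval _).2 IH.
apply: (@multilin_comp _ _ _ _ (below m)
  (fun t => ad_sum (e m) (ext_upto k) t v + ldiff (ins (ext_upto k) (e m)) t v)).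
  exact: below_linear.
move=> s1 s2 a x y; rewrite multilin_ad_sum // multilin_ldiff ?coindE.
  by rewrite scalerDr addrACA.
exact: multilin_ins.
Qed.

Lemma altern_ext_upto k : altern (ext_upto k).
Proof.
apply/altern_eval; elim: k => [|k IH] w.
  case: w => [|c w] //=; exact: altern_comp z'_alt.
rewrite /=; case: (size w <= k)%N; first exact: IH.
case: w => // m v; case: (_ && _) => //.
have El := multilin_ext_upto k; have Ea := (altern_eval _).2 IH.
apply: (@altern_comp _ _ _ _ (below m)
  (fun t => ad_sum (e m) (ext_upto k) t v + ldiff (ins (ext_upto k) (e m)) t v)).
move=> s1 s2 x; rewrite altern_ad_sum // altern_ldiff ?addr0 //.
  exact: multilin_ins.
exact: altern_ins.
Qed.

Lemma multilin_ext_cocycle : multilin ext_cocycle.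
Proof.
by apply/multilin_eval => w; exact: ((multilin_eval _).1 (multilin_ext_upto _) w).
Qed.

Lemma altern_ext_cocycle : altern ext_cocycle.
Proof.
by apply/altern_eval => w; exact: ((altern_eval _).1 (altern_ext_upto _) w).
Qed.

(** The projection applied to all arguments, [pi] at the empty word and [below c] at [c :: v], kills
    [e m]. *)
Lemma ext_cocycle_dominating m s w :
  e m \in s -> dominates m w -> ext_cocycle s w = 0.
Proof.
move=> ms; case: w => [_|c v /= cm].
  rewrite ext_cocycle_nil multilin_mem0 //.
  by apply/mapP; exists (e m) => //; rewrite proj_vec.
have [dw|/ext_cocycle_nondescending ->//] := boolP (descending (c :: v)).
have t0 : 0 \in map (below c) s.
  by apply/mapP; exists (e m) => //; rewrite below_vec cm.
rewrite ext_cocycle_cons // !multilin_mem0 ?addr0 //.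
  exact/multilin_ldiff/multilin_ins/multilin_ext_upto.
exact/multilin_ad_sum/multilin_ext_upto.
Qed.

(** This is the equation solved by the value at [m :: w], except that the recursion uses the
    truncation [ext_upto (size w)] in place of [ext_cocycle]. *)
Lemma ldiff_ext_dominating m s w : descending w -> dominates m w ->
  all (fun x => below m x == x) s -> ldiff ext_cocycle (e m :: s) w = 0.
Proof.
move=> dw mw sm; rewrite ldiff_consE /coind_act dw word_act_dominating //.
have dmw : descending (m :: w).
  by case: (w) dw mw => //= c v dv cm; rewrite /descending /= cm.
rewrite ext_cocycle_cons //.
have -> : map (below m) s = s.
  by rewrite -[RHS]map_id; apply/eq_in_map => x /(allP sm)/eqP.
rewrite (ad_sum_eval _ _ (G := ext_cocycle)) => [|t]; last exact: ext_upto_le.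
rewrite [X in X - _]addrAC subrr add0r -coindB.
have /(congr1 (@^~ s)) /= <- :=
  ldiffB (ins (ext_upto (size w)) (e m)) (ins ext_cocycle (e m)).
(* The truncation is exact up to the length of [w]. At [insert b w] it is 0 by length, and
   [ext_cocycle] is 0 because its argument [e m] dominates that word. *)
apply: (ldiff_vanish (m := m)) => // [t u uw|t b tm mb].
  by rewrite coindB /ins ext_upto_le // subrr.
rewrite coindB /ins ext_upto_gt ?size_insert //.
rewrite (ext_cocycle_dominating (m := m)) ?subrr //.
  exact: mem_head.
exact: dominates_insert.
Qed.

Lemma ldiff_ext_cocycle X : ldiff ext_cocycle X = 0.
Proof.
apply/funext => w; rewrite -[RHS]/(0 : M); have [n] := ubnP (size w).
elim: n w X => // n IH w X wn.
have [dw|ndw] := boolP (descending w); last first.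
  by apply: ldiff_nondescending => // t; exact: ext_cocycle_nondescending.
have dl := multilin_ldiff multilin_ext_cocycle.
have da := altern_ldiff multilin_ext_cocycle altern_ext_cocycle.
apply: (@altern_letters (fun X => ldiff ext_cocycle X w) w).
- exact: (multilin_eval _).1 dl w.
- exact: (altern_eval _).1 da w.
- by move=> m s mw sm; exact: ldiff_ext_dominating.
case: w dw wn => [|m u] dw wn s sw.
  have -> : s = map j (map pi s).
    by rewrite -map_comp -[LHS]map_id; apply/eq_in_map => x /(allP sw)/eqP.
  rewrite (ldiff_restrict (F' := z')) // => t.
  by rewrite ext_cocycle_nil -map_comp map_id_in // => y _; exact: proj_sub.
have [mu du] := descending_cons dw.
(* Short words are covered by induction; insertions of letters below [m] are dominated by [m], so
   the previous lemma applies. *)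
have low0 : (ldiff (ins (ldiff ext_cocycle) (e m)) s : N) u = 0.
  apply: (ldiff_vanish (m := m)) => // [t v vu|t b tm mb].
    by rewrite /ins IH // (leq_ltn_trans vu).
  by apply: ldiff_ext_dominating; rewrite ?descending_insert ?dominates_insert.
(* In [d (d z) = 0] at [e m :: s] and [u], the action of [e m] turns [u] into [m :: u]; this is the
   only term not already known to vanish. *)
have /(congr1 (@^~ u)) := ldiffK (e m :: s) multilin_ext_cocycle.
rewrite [LHS]ldiff_consE /coind_act du word_act_dominating //.
rewrite ad_sum_vanish => [|t]; last exact: IH.
by rewrite subr0 low0 subr0.
Qed.

Lemma ext_cocycle_restrict s : ext_cocycle (map j s) [::] = z' s.
Proof.
by rewrite ext_cocycle_nil -map_comp map_id_in // => y _; exact: proj_sub.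
Qed.

End CocycleExtension.

Lemma cocycle_extension_basis n (z : cocycle M n) :
  exists (N : lieModType h) (eps : N -> M) (zN : cocycle N n),
  [/\ linear eps, forall y m, eps (lact (j y) m) = lact y (eps m)
    & forall x, eps (zN (j \o x)) = z x].
Proof.
have /asboolP zc := cocycleP z; have [zcoch _] := zc.
have zl := multilin_list_cochain zcoch; have za := altern_list_cochain zcoch.
have zd s := ldiff_list_cochain s zc.
have El := multilin_ext_cocycle zl; have Ea := altern_ext_cocycle zl za.
have zNP : (fun x : 'I_n -> h => ext_cocycle (list_cochain z) (codom x)) \in
    @cocycle_pred K h N n.
  apply/asboolP; split=> [|x]; first exact: cochain_codom.
  by rewrite ce_diff_codom // ldiff_ext_cocycle.
(* [eps] evaluates at the empty word, which stands for the unit of [U(h)]. *)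
exists N, (fun psi => psi [::]), (Cocycle zNP); split=> [//|y psi|x] /=.
  by rewrite coind_actE /coind_act /= word_act_nil lin_ext_sub add0r proj_sub.
have -> : codom (j \o x) = map j (codom x) by rewrite /codom /image_mem -map_comp.
by rewrite ext_cocycle_restrict list_cochain_codom.
Qed.

End Coinduced.

(** * Cohomological dimension *)

Lemma cocycle_extension (K : fieldType) (h' h : lieAlgType K) (j : lieHom h' h)
  (M : lieModType h') n (z : cocycle M n) : injective j ->
  exists (N : lieModType h) (eps : N -> M) (zN : cocycle N n),
  [/\ linear eps, forall y m, eps (lact (j y) m) = lact y (eps m)
    & forall x, eps (zN (j \o x)) = z x].
Proof.
move=> j_inj; have [R R_wo] := wochoice.well_ordering_principle h.
have cb : complement_basis j := wo_complement_basis (linearP j) R_wo.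
exact (cocycle_extension_basis j_inj cb z).
Qed.

Lemma cohom_class_eq0 (K : fieldType) (g : lieAlgType K) (M : lieModType g) n
  (z : cocycle M n) : cohom_class z = 0 <-> is_coboundary z.
Proof.
have -> : (0 : cohomology M n) = cohom_class (0 : cocycle M n).
  by apply/esym; exact: pi_zeror.
split=> [/eqP|zb].
  by rewrite /cohom_class -Quotient.idealrBE subr0 => /asboolP.
by apply/eqP; rewrite /cohom_class -Quotient.idealrBE subr0; apply/asboolP.
Qed.

(** A primitive is transported by the same formula, since [eps] intertwines the actions along [i]
    and [i] preserves brackets. *)
Lemma coboundary_transport (K : fieldType) (g g' : lieAlgType K) (i : lieHom g' g)
  (N : lieModType g) (M : lieModType g') (eps : N -> M) n (w : ('I_n -> g) -> N) :
  linear eps -> (forall x m, eps (lact (i x) m) = lact x (eps m)) ->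
  is_coboundary w -> is_coboundary (fun x : 'I_n -> g' => eps (w (i \o x))).
Proof.
move=> eps_lin eps_act; case: n w => [|n] w /= => [w0 x|[c [cl ca] dc]].
  by rewrite w0 (linear_fun0 eps_lin).
exists (fun x => eps (c (i \o x))).
  split=> [k x a u v|x k l kl xkl].
    by rewrite !comp_dfwith linearP cl eps_lin.
  by rewrite (ca _ k l) //= ?xkl // (linear_fun0 eps_lin).
move=> x; rewrite dc /ce_diff (linear_funD eps_lin) !(linear_fun_sum eps_lin).
congr (_ + _); apply: eq_bigr => k _.
  by rewrite (linear_funZ eps_lin) eps_act.
rewrite (linear_fun_sum eps_lin); apply: eq_bigr => l _.
rewrite (linear_funZ eps_lin); congr (_ *: eps (c _)); apply/funext => p /=.
by rewrite /lie_contract; case: ifP => // _; rewrite lie_morphM.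
Qed.

Lemma nonzero_degrees_sub (K : fieldType) (g h g' h' : lieAlgType K)
  (f : lieHom g h) (f' : lieHom g' h') (i : lieHom g' g) (j : lieHom h' h) :
  injective j -> f \o i = j \o f' -> nonzero_degrees f' `<=` nonzero_degrees f.
Proof.
move=> j_inj square n [M [c]]; rewrite /cohom_map; set z := repr c => nz.
have [N [eps [zN [eps_lin eps_act epsE]]]] := cocycle_extension z j_inj.
exists N, (cohom_class zN); rewrite cohom_mapE; apply: contra_neq nz.
move=> /cohom_class_eq0 zb; apply/cohom_class_eq0.
have sq x : f (i x) = j (f' x) by rewrite -[LHS]/((f \o i) x) square.
(* [eps] is read as a map between the restrictions along [f] and [f']; it is [g']-linear because
   [f (i x) = j (f' x)]. *)
have := @coboundary_transport K g g' i (restrict_mod f N) (restrict_mod f' M) eps n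
  _ eps_lin _ zb.
have -> : (fun x : 'I_n -> g' => eps (pullc f zN (i \o x))) = pullc f' z.
  apply/funext => x; rewrite /= /pull -epsE; congr (eps (zN _)).
  by apply/funext => k /=; rewrite sq.
apply=> x m.
by rewrite -[lact (i x) m]/(lact (f (i x)) (m : N)) sq eps_act.
Qed.

Lemma degree_sup_ge (S : set nat) n : S n -> (n%:Z%:E <= degree_sup S)%E.
Proof.
by move=> Sn; have [ub _] := degree_sup_isLub (ex_intro _ n Sn); apply: ub; exists n.
Qed.

Lemma degree_sup_ge0 (S : set nat) : (0%:E <= degree_sup S)%E.
Proof.
have [->|/set0P[n Sn]] := eqVneq S set0.
  by rewrite /degree_sup image_set0 supremum0.
by apply: le_trans (degree_sup_ge Sn); rewrite lee_fin.
Qed.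

Lemma degree_sup_le (S T : set nat) : S `<=` T -> (degree_sup S <= degree_sup T)%E.
Proof.
move=> ST; have [->|/set0P S0] := eqVneq S set0.
  (* An empty [S] has the default supremum 0, which bounds every [degree_sup] from below. *)
  by rewrite {1}/degree_sup image_set0 supremum0 degree_sup_ge0.
have [_ lub] := degree_sup_isLub S0; apply: lub => _ [n /ST Tn <-].
exact: degree_sup_ge.
Qed.

Theorem proposition4p3 (K : fieldType) (g h g' h' : lieAlgType K)
  (f : lieHom g h) (f' : lieHom g' h') (i : lieHom g' g) (j : lieHom h' h)
  (i_inj : injective i) (j_inj : injective j)
  (square : f \o i = j \o f')
  (pullback : range i = f @^-1` range j) :
  (cd f' <= cd f)%E.
Proof. exact/degree_sup_le/(nonzero_degrees_sub j_inj square). Qed.
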